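(* Let $G$ be a countable, discrete, sofic group with sofic approximation $\sigma_i\colon G\to S_{d_i}$. Let $X$ be a compact, metrizable group with $G\curvearrowright X$ by (continuous) automorphisms, and let $m_X$ be the Haar probability measure on $X$. Suppose that there exist $\mu_i\in\operatorname{Prob}(X^{d_i})$ such that $(\mu_i)_i$ locally and doubly empirically converges to $m_X$ (written $\mu_i\to^{lde}m_X$). Then for any closed, normal, $G$-invariant subgroup $Y\subseteq X$ we have $$h_{(\sigma_i)_i,\mathrm{top}}(X/Y:X,G)=h_{(\sigma_i)_i,m_X}(X/Y:X,G).$$ In particular (taking $Y=\{1\}$), the topological entropy $h_{(\sigma_i)_i,\mathrm{top}}(X,G)$ of $G\curvearrowright X$ and the measure-theoretic entropy $h_{(\sigma_i)_i,m_X}(X,G)$ of $G\curvearrowright(X,m_X)$ (both with respect to $(\sigma_i)_i$) agree.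
   Context: **Sofic approximations.** $S_n$ is the group of permutations of $\{1,\dots,n\}$, $u_n$ is the uniform probability measure on $\{1,\dots,n\}$, and for a set $A$, $A^n$ is identified with the functions $\{1,\dots,n\}\to A$. A sequence of maps (not assumed homomorphisms) $\sigma_i\colon G\to S_{d_i}$ is a sofic approximation of $G$ if $u_{d_i}(\{j:\sigma_i(g)\sigma_i(h)(j)=\sigma_i(gh)(j)\})\to1$ for all $g,h\in G$ and $u_{d_i}(\{j:\sigma_i(g)(j)=j\})\to0$ for all $g\in G\setminus\{e\}$. $G$ is sofic if it has a sofic approximation. **Microstates.** Let $X$ be a compact metrizable space with $G\curvearrowright X$ by homeomorphisms. $\operatorname{Prob}(X)$ is the set of Borel probability measures on $X$ and $\operatorname{Prob}_G(X)$ the $G$-invariant ones. A continuous pseudometric $\rho$ on $X$ is dynamically generating if for all $x\neq y$ in $X$ there is $g\in G$ with $\rho(gx,gy)>0$. On $X^n$ put $\rho_2(x,y)=\left(\frac1n\sum_{j=1}^n\rho(x(j),y(j))^2\right)^{1/2}$. For finite $F\subseteq G$ and $\delta>0$, $\operatorname{Map}(\rho,F,\delta,\sigma_i)$ is the set of $\phi\in X^{d_i}$ with $\rho_2(g\phi,\phi\circ\sigma_i(g))<\delta$ for all $g\in F$, where $(g\phi)(j)=g\cdot\phi(j)$. For $\mu\in\operatorname{Prob}_G(X)$ and finite $L\subseteq C(X)$, $\operatorname{Map}_\mu(\rho,F,L,\delta,\sigma_i)$ is the set of $\phi\in\operatorname{Map}(\rho,F,\delta,\sigma_i)$ with $\left|\frac1{d_i}\sum_{j=1}^{d_i}f(\phi(j))-\int_X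 f\,d\mu\right|<\delta$ for all $f\in L$. **Convergence.** $\mu_i\in\operatorname{Prob}(X^{d_i})$ locally and empirically converges to $\mu\in\operatorname{Prob}_G(X)$, written $\mu_i\to^{le}\mu$, if for all finite $F\subseteq G$, finite $L\subseteq C(X)$, and $\delta>0$: $\mu_i(\operatorname{Map}_\mu(\rho,F,L,\delta,\sigma_i))\to1$ and $\min_{f\in L}u_{d_i}\left(\left\{j:\left|\int_X f\,d\mu-\int_{X^{d_i}}f(\phi(j))\,d\mu_i(\phi)\right|<\delta\right\}\right)\to1$. Here $\rho$ is a dynamically generating continuous pseudometric on $X$; the notion does not depend on its choice. $\mu_i$ locally and doubly empirically converges to $\mu$, written $\mu_i\to^{lde}\mu$, if $\mu_i\otimes\mu_i\to^{le}\mu\otimes\mu$, where $\mu_i\otimes\mu_i$ is viewed in $\operatorname{Prob}((X\times X)^{d_i})$ and $G$ acts diagonally on $X\times X$. **Entropy in the presence.** Let $\pi\colon X\to Z$ be a topological factor map (continuous, $G$-equivariant, surjective, $Z$ compact metrizable with $G\curvearrowright Z$ by homeomorphisms), and let $\rho_X,\rho_Z$ be dynamically generating continuous pseudometrics on $X,Z$. For a pseudometric space $(A,d)$, $N_\varepsilon(A,d)$ is the largest cardinality of a subset of $A$ whose distinct points are at distance $>\varepsilon$. Let $\operatorname{Map}(Z:\rho_X,F,\delta,\sigma_i)=\{\pi\circ\phi:\phi\in\operatorname{Map}(\rho_X,F,\delta,\sigma_i)\}$ and $\operatorname{Map}_\mu(Z:\rho_X,F,L,\delta,\sigma_i)=\{\pi\circ\phi:\phi\in\operatorname{Map}_\mu(\rho_X,F,L,\delta,\sigma_i)\}$.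 Define $$h_{(\sigma_i)_i,\mathrm{top}}(Z:X,G)=\sup_{\varepsilon>0}\ \inf_{F,\delta}\ \limsup_{i\to\infty}\frac1{d_i}\log N_\varepsilon(\operatorname{Map}(Z:\rho_X,F,\delta,\sigma_i),\rho_{Z,2}),$$ $$h_{(\sigma_i)_i,\mu}(Z:X,G)=\sup_{\varepsilon>0}\ \inf_{F,L,\delta}\ \limsup_{i\to\infty}\frac1{d_i}\log N_\varepsilon(\operatorname{Map}_\mu(Z:\rho_X,F,L,\delta,\sigma_i),\rho_{Z,2}),$$ with infima over finite $F\subseteq G$, finite $L\subseteq C(X)$, $\delta>0$, and $\log0=-\infty$ (these do not depend on the pseudometrics). When $Z=X$ and $\pi=\mathrm{id}$ these are the topological entropy $h_{(\sigma_i)_i,\mathrm{top}}(X,G)$ and measure-theoretic entropy $h_{(\sigma_i)_i,\mu}(X,G)$. In the claim, $Z=X/Y$ with the induced action and $\pi$ is the quotient map. *)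

(* Defs.v *)
From HB Require Import structures.
From mathcomp Require Import all_boot all_order all_algebra finmap.
From mathcomp Require Import perm generic_quotient.
From mathcomp Require Import all_classical all_reals all_analysis.

Set Implicit Arguments.
Unset Strict Implicit.
Unset Printing Implicit Defensive.

Import Order.TTheory GRing.Theory Num.Theory.
Import numFieldNormedType.Exports.

Local Open Scope classical_set_scope.
Local Open Scope ring_scope.

HB.mixin Record isTopologicalGroup T & Group T & PointedTopological T := {
  mulg_continuous : continuous (fun p : T * T => (p.1 * p.2)%g) ;
  invg_continuous : continuous (fun x : T => x^-1%g)
}.

#[short(type="topologicalGroupType")]
HB.structure Definition TopologicalGroup :=
  {T of isTopologicalGroup T & Group T & PointedTopological T}.

Definition metrizable (R : realType) (X : topologicalType) : Prop :=
  exists d : X -> X -> R,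
    [/\ forall x y, d x y = 0 <-> x = y,
        forall x y, d x y = d y x,
        forall x y z, d x z <= d x y + d y z &
        forall x A, nbhs x A <-> exists2 e, 0 < e & [set y | d x y < e] `<=` A].

Definition compact_metrizable (R : realType) (X : topologicalType) : Prop :=
  compact [set: X] /\ metrizable R X.

(* needed for HB to find the ptopologicalType structure on X * Y *)
HB.instance Definition _ (X Y : ptopologicalType) := Pointed.on (X * Y)%type.

Definition power (A : Type) (n : nat) : Type :=
  prod_topology (fun _ : 'I_n => A).
HB.instance Definition _ (X : choiceType) n :=
  Choice.copy (power X n) ('I_n -> X).
HB.instance Definition _ (X : topologicalType) n :=
  Topological.copy (power X n) (prod_topology (fun _ : 'I_n => X)).
HB.instance Definition _ (X : ptopologicalType) n :=
  Pointed.copy (power X n) ('I_n -> X).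

Definition borel (X : ptopologicalType) := g_sigma_algebraType (@open X).

Lemma compact_metrizable_second_countable (R : realType) (X : ptopologicalType) :
  compact_metrizable R X -> @second_countable X.
Proof.
move=> [cX [d [d0 dC dD dN]]].
pose f n (z : X) : set X := ([set y | d z y < n.+1%:R^-1])°.
have fz n z : f n z z.
  by apply/dN; exists n.+1%:R^-1 => //; rewrite invr_gt0.
have h n : finite_subset_cover [set: X] (f n) [set: X].
  move: cX; rewrite compact_cover; apply.
  - by move=> z _; exact: open_interior.
  - by move=> z _; exists z.
pose h' n := projT1 (cid (iffLR (exists2P _ _) (h n))).
exists (\bigcup_n (f n) @` [set` h' n]); [|split].
- apply: bigcup_countable => // n _; apply: finite_set_countable.
  exact/finite_image/finite_fset.
- by move=> ? [? _ [? _ <-]]; exact: open_interior.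
- move=> x V /dN [e e0 xV].
  have [//|N] := @ltr_add_invr R 0 (e / 2) _; first by rewrite divr_gt0.
  rewrite add0r => Ne.
  have [w wh fx] : exists2 w, w \in h' N & f N w x.
    rewrite /h'; case: cid => /= D [_ /(_ x)[//|w wD fwx]].
    by exists w.
  exists (f N w); first by split => //; exists N => //; exists w.
  move=> z fz'; apply: xV => /=.
  have := interior_subset fx; have := interior_subset fz'; rewrite /= => wz wx.
  rewrite (le_lt_trans (dD _ w _))// (splitr e) ltrD//.
    by rewrite dC (lt_trans wx).
  by rewrite (lt_trans wz).
Qed.

Lemma power_second_countable (X : ptopologicalType) n :
  @second_countable X -> @second_countable (power X n).
Proof.
move=> [B /countable_injP[k kinj] [oB bB]].
pose e m := xget set0 [set b | B b /\ k b = m].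
have ek b : B b -> e (k b) = b.
  move=> Bb; have [Be ke] : B (e (k b)) /\ k (e (k b)) = k b.
    by rewrite /e; case: xgetP => [c -> //|/(_ b)]; case.
  by apply: kinj => //; rewrite inE.
pose box (g : {ffun 'I_n -> nat}) : set (power X n) :=
  [set x | forall i, e (g i) (x i)].
pose D := [set g : {ffun 'I_n -> nat} | forall i, B (e (g i))].
have nbox x (A : 'I_n -> set X) : (forall i, nbhs (x i) (A i)) ->
    nbhs (x : power X n) [set y | forall i, A i (y i)].
  move=> xA.
  apply: (@filter_forall _ _ (fun i => [set y : power X n | A i (y i)])
    (nbhs (x : power X n)) _) => i.
  exact: (@proj_continuous _ (fun _ : 'I_n => X) i x (A i) (xA i)).
have boxP x (A : 'I_n -> set X) : (forall i, nbhs (x i) (A i)) ->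
    exists2 g, D g /\ box g x & box g `<=` [set y | forall i, A i (y i)].
  move=> /(_ _)/bB xA.
  pose b i := projT1 (cid2 (xA i)).
  have bP i : [/\ B (b i), b i (x i) & b i `<=` A i].
    by rewrite /b; case: cid2 => c /= [].
  have eb i : e (k (b i)) = b i by apply: ek; have [] := bP i.
  exists [ffun i => k (b i)].
    by split=> i; rewrite ffunE eb; have [] := bP i.
  by move=> y + i => /(_ i); rewrite ffunE eb; have [_ _] := bP i; exact.
exists (\bigcup_(g in D) [set box g]); [|split].
- by apply: bigcup_countable => // *; exact: countable1.
- move=> _ [g Dg ->]; rewrite openE => x gx; apply: (nbox x (fun i => e (g i))) => i.
  by apply: open_nbhs_nbhs; split; [exact/oB/Dg|exact: gx].
- move=> x; set F := filter_from _ _.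
  have FF : Filter F.
    apply: filter_from_filter.
      have [g [Dg gx] _] := @boxP x (fun=> setT) (fun=> filterT).
      by exists (box g); split => //; exists g.
    move=> _ _ [[g Dg ->] gx] [[h Dh ->] hx].
    have [i|l [Dl lx] lgh] := @boxP x (fun i => e (g i) `&` e (h i)).
      by apply: open_nbhs_nbhs; split; [apply: openI; exact/oB|split].
    exists (box l); first by split => //; exists l.
    by move=> y /lgh ygh; split => i; have [] := ygh i.
  apply/cvg_sup => i A [_ [[C oC <-] Cx] CA].
  have [j|g [Dg gx] gA] := @boxP x (fun j => if j == i then C else setT).
    by case: eqP => [->|_]; [exact: open_nbhs_nbhs|exact: filterT].
  exists (box g); first by split => //; exists g.
  by move=> y /gA /(_ i); rewrite eqxx => /CA.
Qed.

Lemma open_prod_borel_measurable (S T : ptopologicalType) (W : set (S * T)) :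
  @second_countable S -> @second_countable T -> open W ->
  measurable (W : set (borel S * borel T)).
Proof.
move=> [B cB [oB bB]] [C cC [oC bC]] oW.
pose I := [set p | [/\ B p.1, C p.2 & p.1 `*` p.2 `<=` W]].
have -> : W = \bigcup_(p in I) (p.1 `*` p.2).
  apply/seteqP; split => [[x y] Wxy|z [p [_ _ pW] /pW]//].
  have [[P Q] /= [/bB[P' [BP' P'x] P'P] /bC[Q' [CQ' Q'y] Q'Q]] PQW] :
      nbhs (x, y) W by exact: open_nbhs_nbhs.
  exists (P', Q') => //; split => //= -[u v] [/= P'u Q'v].
  by apply: PQW; split; [exact: P'P|exact: Q'Q].
rewrite bigcup_set_type; apply: countable_bigcupT_measurable.
  rewrite (eq_countable (card_setT I)).
  apply: sub_countable (countableX cB cC); apply: subset_card_le.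
  by move=> p [].
move=> [p /set_mem[Bp Cp _]] /=.
by apply: measurableX; apply: sub_sigma_algebra; [exact: oB|exact: oC].
Qed.

Lemma continuous_prod_borel_measurable (S T U : ptopologicalType)
    (f : S * T -> U) :
  @second_countable S -> @second_countable T -> continuous f ->
  measurable_fun [set: borel S * borel T] (f : borel S * borel T -> borel U).
Proof.
move=> cS cT /continuousP cf.
apply: (@measurability _ _ (borel S * borel T)%type (borel U) _ _ (@open U)).
  by [].
move=> _ [V oV <-]; rewrite setTI.
exact: open_prod_borel_measurable (cf _ oV).
Qed.

Definition zip_power (X : Type) n (p : power X n * power X n) :
  power (X * X)%type n := fun j => (p.1 j, p.2 j).

Lemma zip_power_continuous (X : ptopologicalType) n :
  continuous (@zip_power X n).
Proof.
move=> -[x y]; apply/cvg_sup => i A [_ [[C oC <-] Cxy] CA].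
have [[P Q] /= [Px Qy] PQC] : nbhs (x i, y i) C by exact: open_nbhs_nbhs.
exists ([set u : power X n | P (u i)], [set u : power X n | Q (u i)]) => /=.
  split.
    exact: (@proj_continuous _ (fun _ : 'I_n => X) i x P Px).
  exact: (@proj_continuous _ (fun _ : 'I_n => X) i y Q Qy).
by move=> [u v] [/= Pu Qv]; apply: CA; apply: (PQC (u i, v i)).
Qed.

Lemma idfun_prod_borel_measurable (R : realType) (X : ptopologicalType) :
  compact_metrizable R X ->
  measurable_fun [set: borel X * borel X]
    (id : borel X * borel X -> borel (X * X)%type).
Proof.
move=> /compact_metrizable_second_countable cX.
apply: (@continuous_prod_borel_measurable X X (X * X)%type id cX cX).
by move=> p; exact: cvg_id.
Qed.

Lemma zip_power_measurable (R : realType) (X : ptopologicalType) n :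
  compact_metrizable R X ->
  measurable_fun [set: borel (power X n) * borel (power X n)]
    (@zip_power X n : _ -> borel (power (X * X)%type n)).
Proof.
move=> /compact_metrizable_second_countable/power_second_countable - /(_ n) cX.
exact: (continuous_prod_borel_measurable cX cX (@zip_power_continuous X n)).
Qed.

(* The library's [mu \x nu] lives on the product sigma-algebra; the next two
   definitions transport it to the Borel sigma-algebras of X * X and
   (X * X)^n, the latter through the identification X^n * X^n = (X * X)^n. *)
Definition prod_prob (R : realType) (X : ptopologicalType)
    (cmX : compact_metrizable R X) (mu nu : probability (borel X) R) :
    probability (borel (X * X)%type) R :=
  distribution (mu \x nu)%E
    (mfun_Sub (mem_set (idfun_prod_borel_measurable cmX))).

Definition prod_prob_power (R : realType) (X : ptopologicalType) n
    (cmX : compact_metrizable R X) (mu nu : probability (borel (power X n)) R) :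
    probability (borel (power (X * X)%type n)) R :=
  distribution (mu \x nu)%E
    (mfun_Sub (mem_set (@zip_power_measurable R X n cmX))).

(* Left invariance suffices: X is compact and metrizable where this is used, so m
   is the unique left Haar probability and is also right invariant. *)
Definition haar (R : realType) (X : topologicalGroupType)
    (m : probability (borel X) R) : Prop :=
  forall (x : X) (A : set (borel X)), measurable A ->
    m [set (x * a)%g | a in A] = m A.

(* u_n({j : P j}) *)
Definition unif (R : realType) n (P : pred 'I_n) : R :=
  #|P|%:R / n%:R.

(* u_n is a probability measure only for 0 < n; the product of permutations is
   written pointwise because [*] on 'S_n composes from left to right. *)
Definition sofic_approximation (R : realType) (G : groupType) (d : nat -> nat)
    (s : forall i, G -> 'S_(d i)) : Prop :=
  [/\ forall i, (0 < d i)%N,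
      forall g h, unif R (fun j => s i g (s i h j) == s i (g * h)%g j)
        @[i --> \oo] --> (1 : R) &
      forall g, g != 1%g ->
        unif R (fun j => s i g j == j) @[i --> \oo] --> (0 : R)].

Record topAction (G : groupType) (X : topologicalType) := TopAction {
  act :> G -> X -> X ;
  act1 : forall x, act 1%g x = x ;
  actM : forall g h x, act (g * h)%g x = act g (act h x) ;
  act_continuous : forall g, continuous (act g) }.

Record autAction (G : groupType) (X : topologicalGroupType) := AutAction {
  aut_action :> topAction G X ;
  aut_actM : forall g, {morph aut_action g : x y / (x * y)%g} }.

Definition diag_fun (G X : Type) (a : G -> X -> X) g (p : X * X) :=
  (a g p.1, a g p.2).

Section diagonal_action.
Context (G : groupType) (X : topologicalType) (a : topAction G X).

Let diag1 p : diag_fun a 1%g p = p.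
Proof. by case: p => x y; rewrite /diag_fun !act1. Qed.

Let diagM g h p : diag_fun a (g * h)%g p = diag_fun a g (diag_fun a h p).
Proof. by rewrite /diag_fun !actM. Qed.

Let diag_continuous g : continuous (diag_fun a g).
Proof.
move=> p; apply: cvg_pair.
  by apply: continuous_comp; [exact: cvg_fst|exact: act_continuous].
by apply: continuous_comp; [exact: cvg_snd|exact: act_continuous].
Qed.

Definition diag_action : topAction G (X * X)%type :=
  TopAction diag1 diagM diag_continuous.

End diagonal_action.

Record continuous_pseudometric (R : realType) (X : topologicalType)
    (rho : X -> X -> R) : Prop := {
  pm_ge0 : forall x y, 0 <= rho x y ;
  pm_refl : forall x, rho x x = 0 ;
  pm_sym : forall x y, rho x y = rho y x ;
  pm_triangle : forall x y z, rho x z <= rho x y + rho y z ;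
  pm_continuous : continuous (fun p : X * X => rho p.1 p.2) }.

Definition dynamically_generating (R : realType) (G : groupType)
    (X : topologicalType) (a : topAction G X) (rho : X -> X -> R) : Prop :=
  forall x y, x <> y -> exists g, 0 < rho (a g x) (a g y).

Definition rho2 (R : realType) (X : Type) n (rho : X -> X -> R)
    (x y : power X n) : R :=
  Num.sqrt (n%:R^-1 * \sum_(j < n) rho (x j) (y j) ^+ 2).

Section microstates.
Context (R : realType) (G : groupType).

Definition Map (X : topologicalType) (a : topAction G X) (rho : X -> X -> R)
    (F : {fset G}) (delta : R) n (s : G -> 'S_n) : set (power X n) :=
  [set phi | forall g, g \in F ->
    rho2 rho (fun j => a g (phi j)) (fun j => phi (s g j)) < delta].

(* C(X) is taken real-valued; continuity of the members of L is required where
   L is quantified. *)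
Definition Map_mu (X : ptopologicalType) (a : topAction G X)
    (mu : probability (borel X) R) (rho : X -> X -> R) (F : {fset G})
    (L : {fset (X -> R)}) (delta : R) n (s : G -> 'S_n) : set (power X n) :=
  [set phi | Map a rho F delta s phi /\ forall f, f \in L ->
    `| n%:R^-1 * (\sum_(j < n) f (phi j)) - \int[mu]_x f x | < delta].

Definition le_converges (X : ptopologicalType) (a : topAction G X)
    (rho : X -> X -> R) (d : nat -> nat) (s : forall i, G -> 'S_(d i))
    (mu_ : forall i, probability (borel (power X (d i))) R)
    (mu : probability (borel X) R) : Prop :=
  forall (F : {fset G}) (L : {fset (X -> R)}) (delta : R),
    (forall f, f \in L -> continuous f) -> 0 < delta ->
    mu_ i (Map_mu a mu rho F L delta (s i)) @[i --> \oo] --> (1%E : \bar R) /\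
    (* the initial value 1 bounds all terms, and is the minimum for L empty *)
    \big[Num.min/1]_(f <- L) unif R (fun j : 'I_(d i) =>
        `| \int[mu]_x f x - \int[mu_ i]_phi f (phi j) | < delta)
      @[i --> \oo] --> (1 : R).

Definition lde_converges (X : ptopologicalType) (cmX : compact_metrizable R X)
    (a : topAction G X) (rho : X * X -> X * X -> R) (d : nat -> nat)
    (s : forall i, G -> 'S_(d i))
    (mu_ : forall i, probability (borel (power X (d i))) R)
    (mu : probability (borel X) R) : Prop :=
  le_converges (diag_action a) rho s
    (fun i => prod_prob_power cmX (mu_ i) (mu_ i)) (prod_prob cmX mu mu).

End microstates.

Section entropy.
Context (R : realType) (G : groupType) (Z : topologicalType).
Local Open Scope ereal_scope.

(* the supremum makes sense for every A; it is a maximum when A is totally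
   bounded *)
Definition sep_number (T : choiceType) (eps : R) (A : set T) (dist : T -> T -> R)
    : \bar R :=
  ereal_sup [set (#|` S|)%:R%:E | S in [set S : {fset T} | [set` S] `<=` A /\
    forall x y, x \in S -> y \in S -> x != y -> (eps < dist x y)%R]].

Definition entropy_rate (d : nat -> nat) (A : forall i, set (power Z (d i)))
    (rhoZ : Z -> Z -> R) (eps : R) : \bar R :=
  limn_esup (fun i =>
    ((d i)%:R^-1)%:E * lne (sep_number eps (A i) (rho2 rhoZ))).

Definition map_power (X : Type) (pi : X -> Z) n (phi : power X n) : power Z n :=
  fun j => pi (phi j).

Definition top_entropy_presence (X : topologicalType) (a : topAction G X)
    (pi : X -> Z) (rhoX : X -> X -> R) (rhoZ : Z -> Z -> R)
    (d : nat -> nat) (s : forall i, G -> 'S_(d i)) : \bar R :=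
  ereal_sup [set
    ereal_inf [set
      entropy_rate
        (fun i => map_power pi (n := d i) @` Map a rhoX p.1 p.2 (s i)) rhoZ eps
      | p in [set p : {fset G} * R | (0 < p.2)%R]]
    | eps in [set eps : R | (0 < eps)%R]].

Definition measure_entropy_presence (X : ptopologicalType) (a : topAction G X)
    (mu : probability (borel X) R) (pi : X -> Z) (rhoX : X -> X -> R)
    (rhoZ : Z -> Z -> R) (d : nat -> nat) (s : forall i, G -> 'S_(d i))
    : \bar R :=
  ereal_sup [set
    ereal_inf [set
      entropy_rate
        (fun i => map_power pi (n := d i) @`
                    Map_mu a mu rhoX p.1.1 p.1.2 p.2 (s i)) rhoZ eps
      | p in [set p : {fset G} * {fset (X -> R)} * R |
          (forall f, f \in p.1.2 -> continuous f) /\ (0 < p.2)%R]]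
    | eps in [set eps : R | (0 < eps)%R]].

End entropy.

(* In the next two definitions Z = X, and rhoX, rhoX' play the roles of rho_X and
   rho_Z. *)
Definition top_entropy (R : realType) (G : groupType) (X : topologicalType)
    (a : topAction G X) (rhoX rhoX' : X -> X -> R) (d : nat -> nat)
    (s : forall i, G -> 'S_(d i)) : \bar R :=
  top_entropy_presence a id rhoX rhoX' s.

Definition measure_entropy (R : realType) (G : groupType)
    (X : ptopologicalType) (a : topAction G X) (mu : probability (borel X) R)
    (rhoX rhoX' : X -> X -> R) (d : nat -> nat) (s : forall i, G -> 'S_(d i))
    : \bar R :=
  measure_entropy_presence a mu id rhoX rhoX' s.

Record closedNormalInvariant (G : groupType) (X : topologicalGroupType)
    (a : autAction G X) := ClosedNormalInvariant {
  cni_set : set X ;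
  cni_closed : closed cni_set ;
  cni1 : cni_set 1%g ;
  cniM : forall x y, cni_set x -> cni_set y -> cni_set (x * y)%g ;
  cniV : forall x, cni_set x -> cni_set x^-1%g ;
  cni_normal : forall x y, cni_set y -> cni_set (x^-1 * y * x)%g ;
  cni_inv : forall g y, cni_set y -> cni_set (a g y) }.

Section quotient_action.
Context (G : groupType) (X : topologicalGroupType) (a : autAction G X)
  (Y : closedNormalInvariant a).
Local Open Scope quotient_scope.

Definition coset_rel : rel X := fun x y => `[< cni_set Y (x^-1 * y)%g >].

Let coset_rel_refl : reflexive coset_rel.
Proof. by move=> x; apply/asboolP; rewrite mulVg; exact: cni1. Qed.

Let coset_rel_sym : symmetric coset_rel.
Proof.
suff H x y : coset_rel x y -> coset_rel y x by move=> x y; apply/idP/idP; exact: H.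
move=> /asboolP/cniV Yxy; apply/asboolP.
by move: Yxy; rewrite invgM invgK.
Qed.

Let coset_rel_trans : transitive coset_rel.
Proof.
move=> y x z /asboolP Yxy /asboolP Yyz; apply/asboolP.
by have := cniM Yxy Yyz; rewrite mulgA mulgK.
Qed.

Definition coset_equiv : equiv_rel X :=
  EquivRel coset_rel coset_rel_refl coset_rel_sym coset_rel_trans.

Definition quotient : topologicalType := quotient_topology {eq_quot coset_equiv}.

Definition quotient_map : X -> quotient :=
  \pi_(quotient_topology {eq_quot coset_equiv}).

Definition quotient_act (g : G) (q : quotient) : quotient :=
  quotient_map (a g (repr (q : quotient_topology {eq_quot coset_equiv}))).

Lemma quotient_map_eq x y : quotient_map x = quotient_map y <-> cni_set Y (x^-1 * y)%g.
Proof.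
split=> [|Yxy].
  by move=> /eqmodP/asboolP.
by apply/eqmodP/asboolP.
Qed.

Lemma quotient_map_surj q : exists x, quotient_map x = q.
Proof.
exists (repr (q : quotient_topology {eq_quot coset_equiv})); exact: reprK.
Qed.

Lemma quotient_map_equivariant g x :
  quotient_map (a g x) = quotient_act g (quotient_map x).
Proof.
apply/quotient_map_eq.
have : cni_set Y (x^-1 * repr (quotient_map x : quotient_topology {eq_quot coset_equiv}))%g.
  by apply/quotient_map_eq; rewrite /quotient_map reprK.
move=> /(cni_inv g); rewrite aut_actM.
suff -> : a g x^-1%g = (a g x)^-1%g by [].
apply: (@mulgI _ (a g x)); rewrite -aut_actM !mulgV.
by apply: (@mulgI _ (a g 1%g)); rewrite -aut_actM !mulg1.
Qed.

Let quotient_act1 q : quotient_act 1%g q = q.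
Proof.
by have [x <-] := quotient_map_surj q; rewrite -quotient_map_equivariant act1.
Qed.

Let quotient_actM g h q :
  quotient_act (g * h)%g q = quotient_act g (quotient_act h q).
Proof.
have [x <-] := quotient_map_surj q.
by rewrite -!quotient_map_equivariant actM.
Qed.

Let quotient_act_continuous g : continuous (quotient_act g).
Proof.
apply/quotient_continuous.
rewrite (_ : _ \o _ = quotient_map \o a g); last first.
  by apply/funext => x /=; rewrite -quotient_map_equivariant.
move=> x; apply: continuous_comp; first exact: act_continuous.
exact: pi_continuous.
Qed.

Definition quotient_action : topAction G quotient :=
  TopAction quotient_act1 quotient_actM quotient_act_continuous.

End quotient_action.

(* Main.v *)
Require Import Defs.
From mathcomp Require Import all_boot all_order all_algebra finmap.
From mathcomp Require Import perm.
From mathcomp Require Import all_classical all_reals all_analysis.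
From mathcomp Require Import measurable_realfun ring lra.

Set Implicit Arguments.
Unset Strict Implicit.
Unset Printing Implicit Defensive.

Import Order.TTheory GRing.Theory Num.Theory.
Import numFieldNormedType.Exports.

Local Open Scope classical_set_scope.
Local Open Scope ring_scope.

(** Let x be drawn from mu_i and let phi be an almost equivariant microstate. Then
    the pointwise product phi * x is, with probability close to 1 uniformly in phi,
    a microstate for the Haar measure.  It is almost equivariant because G acts by
    automorphisms.  Its empirical distribution is close to m: writing v(x) for the
    vector (v(x_j))_j of a function v of mean zero, lde convergence says that
    <v(x), v(x')> is small for independent x and x', so the covariance of v(x) has
    small Hilbert-Schmidt norm and <w, v(x)> is small for every fixed bounded w;
    a finite net of left translates y |-> f(y .) reduces f(phi_j x_j) to such
    weighted averages, and left invariance of m supplies the common mean.  Hence,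
    for a separated set of microstates phi, some single x moves almost all of them
    into the microstates of m, and right translation by x keeps them separated. *)

(** * Averages and compactness *)

(** The pseudometrics [rhoX] on [X], [rho] on [X * X] and [rhoZ] on the factor only generate
    dynamically: none need bound another pointwise, and right translation need not preserve any of
    them. Compactness supplies the substitute. If a continuous [u] is positive only where some
    [v g >= 0] is positive, then [u <= eta + C * \sum_g v g] over finitely many [g]; almost
    equivariance trades each [g] for a permutation of the coordinates, and averages do not see
    permutations. This serves twice: for the almost equivariance of [phi * x], and for separation
    after translation, at a smaller scale determined by the old scale alone. Uniformity in [phi]
    comes from putting all dependence on [phi] into bounded weights [w]: the exceptional pairs are
    determined by [v], before any weight is named. *)

Lemma continuous_pair (T U V : topologicalType) (f : T -> U) (g : T -> V) :
  continuous f -> continuous g -> continuous (fun t => (f t, g t)).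
Proof. by move=> cf cg t; apply: cvg_pair; [exact: cf|exact: cg]. Qed.

Lemma continuous_compose (T U V : topologicalType) (f : T -> U) (g : U -> V) :
  continuous f -> continuous g -> continuous (fun t => g (f t)).
Proof. by move=> cf cg t; apply: continuous_comp; [exact: cf|exact: cg]. Qed.

Lemma continuous_fst (T U : topologicalType) : continuous (@fst T U).
Proof. by move=> p; exact: cvg_fst. Qed.

Lemma continuous_snd (T U : topologicalType) : continuous (@snd T U).
Proof. by move=> p; exact: cvg_snd. Qed.

Lemma open_lt_continuous (R : realType) (T : topologicalType) (f g : T -> R) :
  continuous f -> continuous g -> open [set t | f t < g t].
Proof.
move=> cf cg.
rewrite (_ : [set t | _] = (fun t => g t - f t) @^-1` [set x | 0 < x]).
  apply: open_comp; last exact: open_gt.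
  by move=> t _; apply: continuousB; [exact: cg|exact: cf].
by apply/seteqP; split => t /=; rewrite subr_gt0.
Qed.

Lemma compact_continuous_bounded (R : realType) (T : topologicalType)
    (f : T -> R) :
  compact [set: T] -> continuous f -> exists2 M, 0 < M & forall t, `|f t| <= M.
Proof.
move=> cT cf.
have : compact (f @` [set: T]).
  by apply: continuous_compact => //; exact: continuous_subspaceT.
move=> /(@compact_bounded _ R^o) [M [_ MP]].
exists (`|M| + 1); first by rewrite ltr_wpDl.
move=> t; apply: MP; last by exists t.
by rewrite (le_lt_trans (ler_norm M))// ltrDl.
Qed.

(* The open sets [u < eta + N * v_g] cover the compact space. *)
Lemma compact_domination (R : realType) (T : ptopologicalType) (I : choiceType)
    (i0 : I) (u : T -> R) (v : I -> T -> R) :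
  compact [set: T] -> continuous u -> (forall i, continuous (v i)) ->
  (forall i t, 0 <= v i t) ->
  (forall t, 0 < u t -> exists i, 0 < v i t) ->
  forall eta : R, 0 < eta -> exists (E : {fset I}) (C : R),
    0 <= C /\ forall t, u t <= eta + C * \sum_(i <- E) v i t.
Proof.
move=> cT cu cv v0 uv eta eta0.
pose f (p : I * nat) : set T := [set t | u t < eta + p.2%:R * v p.1 t].
have [D _ coverD] : finite_subset_cover [set: I * nat] f [set: T].
  move: cT; rewrite compact_cover; apply.
    move=> [i n] _; apply: open_lt_continuous => // t.
    apply: (@continuousD _ _ _ (fun=> eta) (fun t => n%:R * v i t)).
      exact: cst_continuous.
    by apply: continuousM; [exact: cst_continuous|exact: cv].
  (* Where [u t <= 0] the multiple [n = 0] suffices; elsewhere [n] is taken above [u t / v i t]. *)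
  move=> t _; have [ut|ut] := leP (u t) 0.
    by exists (i0, 0%N) => //=; rewrite /f/= mul0r addr0 (le_lt_trans ut).
  have [i vi] := uv t ut.
  exists (i, (Num.truncn (u t / v i t)).+1) => //=; rewrite /f/=.
  rewrite -ltrBlDl (@lt_trans _ _ (u t)) ?ltrBlDl ?ltrDr//.
  by rewrite -ltr_pdivrMr//; apply: truncnS_gt.
(* The sum of all multiples dominates each of them, so one [C] serves every set of the cover. *)
exists [fset p.1 | p in D]%fset, (\sum_(p <- D) p.2%:R); split.
  by apply: sumr_ge0 => p _.
move=> t; have [p pD] := coverD t Logic.I; rewrite /f/= => /ltW/le_trans; apply.
rewrite lerD2l ler_pM//.
- by rewrite (big_fsetD1 p)//= lerDl sumr_ge0.
- by rewrite (big_fsetD1 p.1) ?in_imfset//= lerDl sumr_ge0.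
Qed.

(** This is the expression under the root in [rho2], so microstate conditions become bounds on
    averages of squares. For [n = 0] the value is 0. *)
Definition avg (R : realType) n (u : 'I_n -> R) : R := n%:R^-1 * \sum_(j < n) u j.

Section avg_theory.
Context (R : realType) (n : nat).
Implicit Types u v : 'I_n -> R.

Lemma eq_avg u v : u =1 v -> avg u = avg v.
Proof. by move=> uv; rewrite /avg (eq_bigr v). Qed.

Lemma le_avg u v : (forall j, u j <= v j) -> avg u <= avg v.
Proof. by move=> uv; rewrite ler_wpM2l ?invr_ge0 ?ler_sum. Qed.

Lemma avg_ge0 u : (forall j, 0 <= u j) -> 0 <= avg u.
Proof. by move=> u0; rewrite mulr_ge0 ?invr_ge0 ?sumr_ge0. Qed.

Lemma avgD u v : avg (fun j => u j + v j) = avg u + avg v.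
Proof. by rewrite /avg big_split/= mulrDr. Qed.

Lemma avgZ c u : avg (fun j => c * u j) = c * avg u.
Proof. by rewrite /avg -mulr_sumr mulrCA. Qed.

Lemma avgB u v : avg (fun j => u j - v j) = avg u - avg v.
Proof. by rewrite /avg sumrB mulrBr. Qed.

Lemma avg_sum (I : Type) (r : seq I) (F : I -> 'I_n -> R) :
  avg (fun j => \sum_(i <- r) F i j) = \sum_(i <- r) avg (F i).
Proof. by rewrite /avg exchange_big/= -mulr_sumr. Qed.

Lemma avg_perm (p : 'S_n) u : avg (fun j => u (p j)) = avg u.
Proof. by rewrite /avg [in RHS](reindex_inj (@perm_inj _ p)). Qed.

Lemma avg_cst (c : R) : (0 < n)%N -> avg (fun _ : 'I_n => c) = c.
Proof.
move=> n0; rewrite /avg sumr_const card_ord -[c *+ n]mulr_natl mulKf//.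
by rewrite pnatr_eq0 -lt0n.
Qed.

Lemma normr_avg u : `|avg u| <= avg (fun j => `|u j|).
Proof.
by rewrite /avg normrM ger0_norm ?invr_ge0// ler_wpM2l ?invr_ge0// ler_norm_sum.
Qed.

Lemma avg_indicator (P : pred 'I_n) : avg (fun j => (P j)%:R) = unif R P.
Proof.
rewrite /avg /unif mulrC; congr (_ / _).
by rewrite -natr_sum -big_mkcond/= sum1_card.
Qed.

Lemma rho2_lt (X : Type) (rho : X -> X -> R) (x y : power X n) (e : R) :
  0 < e -> (rho2 rho x y < e) = (avg (fun j => rho (x j) (y j) ^+ 2) < e ^+ 2).
Proof.
move=> e0; rewrite /rho2 -/(avg (fun j => rho (x j) (y j) ^+ 2)).
rewrite -[in RHS]ltr_sqrt ?exprn_gt0//.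
by rewrite sqrtr_sqr gtr0_norm.
Qed.

Lemma rho2_le (X : Type) (rho : X -> X -> R) (x y : power X n) (e : R) :
  0 <= e -> (rho2 rho x y <= e) = (avg (fun j => rho (x j) (y j) ^+ 2) <= e ^+ 2).
Proof.
move=> e0; rewrite /rho2 -/(avg (fun j => rho (x j) (y j) ^+ 2)).
by rewrite -[in LHS](ger0_norm e0) -sqrtr_sqr ler_sqrt ?sqr_ge0.
Qed.

End avg_theory.

(** * Comparison of pseudometrics on microstates *)

Lemma near_fset (I : choiceType) (D : {fset I}) (P : I -> nat -> Prop) :
  (forall i, i \in D -> \forall n \near \oo, P i n) ->
  \forall n \near \oo, forall i, i \in D -> P i n.
Proof.
move=> DP; have : \oo (\bigcap_(i in [set` D]) P i) by exact: filter_bigI.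
by apply: filterS => n nP i iD; exact: nP.
Qed.

Lemma sofic_defect (R : realType) (G : groupType) (d : nat -> nat)
    (s : forall i, G -> 'S_(d i)) (E F : {fset G}) (tau : R) :
  sofic_approximation R s -> 0 < tau ->
  \forall i \near \oo, forall g h, g \in E -> h \in F ->
    avg (fun j => (s i (g * h)%g j != s i g (s i h j))%:R) < tau.
Proof.
move=> [d0 sM _] tau0.
have : \forall i \near \oo, forall p, p \in (E `*` F)%fset ->
    avg (fun j => (s i (p.1 * p.2)%g j != s i p.1 (s i p.2 j))%:R) < tau.
  apply: near_fset => -[g h] _.
  move/cvgrPdist_lt : (sM g h) => /(_ _ tau0); apply: filterS => i /=.
  apply: le_lt_trans; apply: le_trans (ler_norm _).
  rewrite -avg_indicator -[X in X - _](@avg_cst _ _ 1 (d0 i)) -avgB.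
  by apply: le_avg => j; rewrite eq_sym; case: eqP => _; rewrite ?subrr ?subr0.
move=> H; apply: filterS H => i H g h gE hF.
by apply: (H (g, h)); rewrite in_fsetM gE.
Qed.

(* The points g (h phi_j) and g (phi_{s h j}) are compared through phi_{s (gh) j}
   and phi_{s g (s h j)}, which coincide for most j. *)
Lemma microstate_domination (R : realType) (G : groupType) (d : nat -> nat)
    (s : forall i, G -> 'S_(d i)) (W : ptopologicalType) (al : G -> W -> W)
    (q D : W -> W -> R) :
  sofic_approximation R s -> compact [set: W] ->
  (forall g h w, al (g * h)%g w = al g (al h w)) ->
  (forall g, continuous (al g)) ->
  continuous (fun p : W * W => q p.1 p.2) ->
  (forall w w', 0 <= q w w') -> (forall w, q w w = 0) ->
  (forall w w', q w w' = q w' w) ->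
  (forall w1 w2 w3 w4, q w1 w4 <= 3 * (q w1 w2 + q w2 w3 + q w3 w4)) ->
  continuous (fun p : W * W => D p.1 p.2) ->
  (forall w w', 0 < D w w' -> exists g, 0 < q (al g w) (al g w')) ->
  forall (F : {fset G}) (delta : R), 0 < delta ->
  exists (F0 : {fset G}) (delta0 : R), 0 < delta0 /\
    \forall i \near \oo, forall phi : 'I_(d i) -> W,
      (forall g, g \in F0 -> avg (fun j => q (al g (phi j)) (phi (s i g j))) < delta0) ->
      forall h, h \in F -> avg (fun j => D (al h (phi j)) (phi (s i h j))) < delta.
Proof.
move=> sofic cW alM cal cq q0 qxx qC q3 cD Dq F delta delta0.
have cWW : compact [set: W * W] by rewrite -setXTT; exact: compact_setX.
have cqg g : continuous (fun p : W * W => q (al g p.1) (al g p.2)).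
  move=> p; apply: (@continuous_comp _ _ _ (fun p : W * W => (al g p.1, al g p.2))
    (fun p => q p.1 p.2)); last exact: cq.
  by apply: cvg_pair; apply: continuous_comp;
    [exact: cvg_fst|exact: cal|exact: cvg_snd|exact: cal].
have [M M0 qM] : exists2 M, 0 < M & forall w w', q w w' <= M.
  have [M M0 HM] := compact_continuous_bounded cWW cq.
  by exists M => // w w'; rewrite (le_trans (ler_norm _))//; exact: (HM (w, w')).
(* The default index [1%g] takes care of the points where [D] is not positive. *)
have [E [C [C0 EC]]] := compact_domination 1%g cWW cD cqg
  (fun g p => q0 _ _) (fun p => Dq p.1 p.2) (divr_gt0 delta0 (ltr0Sn R 1)).
(* Three terms of size at most [tau] and the factor 3 of [q3] give [9 * tau] for each [g]; since
   [18 = 2 * 9], the sum over [E] times [C] stays below [delta / 2]. *)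
have den_gt0 : 0 < 18 * (C + 1) * ((size E)%:R + 1) by rewrite !mulr_gt0 ?ltr_wpDl.
pose tau := delta / (18 * (C + 1) * ((size E)%:R + 1)).
have tau0 : 0 < tau by rewrite divr_gt0.
exists (E `|` [fset (g * h)%g | g in E, h in F])%fset, tau; split => //.
apply: filterS (sofic_defect E F sofic (divr_gt0 tau0 M0)) => i defect.
have [d0 _ _] := sofic.
move=> phi phiP h hF.
have step g : g \in E ->
    avg (fun j => q (al g (al h (phi j))) (al g (phi (s i h j)))) <= 9 * tau.
  move=> gE.
  have /ltW H1 : avg (fun j => q (al g (al h (phi j))) (phi (s i (g * h)%g j))) < tau.
    under eq_avg do rewrite -alM; apply: phiP.
    by rewrite inE; apply/orP; right; apply/imfset2P; exists g => //; exists h.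
  (* [q] vanishes where the two permutations agree and is at most [M] on the sofic defect, whose
     density is below [tau / M]. *)
  have H2 : avg (fun j => q (phi (s i (g * h)%g j)) (phi (s i g (s i h j)))) <= tau.
    apply: (@le_trans _ _ (M * avg (fun j =>
        (s i (g * h)%g j != s i g (s i h j))%:R))).
      rewrite -avgZ; apply: le_avg => j.
      by case: eqP => [->|_] /=; rewrite ?qxx ?mulr0// mulr1.
    by rewrite mulrC -ler_pdivlMr// ltW// defect.
  have /ltW H3 : avg (fun j => q (phi (s i g (s i h j))) (al g (phi (s i h j)))) < tau.
    (* Reindexing by [s i h] leaves the microstate condition for [g] itself. *)
    rewrite (avg_perm (s i h) (fun j => q (phi (s i g j)) (al g (phi j)))).
    by under eq_avg do rewrite qC; apply: phiP; rewrite inE gE.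
  apply: (@le_trans _ _ (avg (fun j => 3 * (
      q (al g (al h (phi j))) (phi (s i (g * h)%g j)) +
      q (phi (s i (g * h)%g j)) (phi (s i g (s i h j))) +
      q (phi (s i g (s i h j))) (al g (phi (s i h j))))))).
    by apply: le_avg => j; exact: q3.
  by rewrite avgZ !avgD; lra.
apply: (@le_lt_trans _ _ (avg (fun j => delta / 2 + C * \sum_(g <- E)
    q (al g (al h (phi j))) (al g (phi (s i h j)))))).
  by apply: le_avg => j; exact: (EC (_, _)).
rewrite avgD avg_cst// avgZ avg_sum.
apply: (@le_lt_trans _ _ (delta / 2 + C * ((size E)%:R * (9 * tau)))).
  rewrite lerD2l ler_wpM2l//.
  rewrite (_ : _ * _ = \sum_(g <- E) 9 * tau); last first.
    by rewrite big_const_seq count_predT iter_addr_0 -[RHS]mulr_natl.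
  by rewrite big_seq [leRHS]big_seq; apply: ler_sum => g; exact: step.
have -> : delta = 18 * (C + 1) * ((size E)%:R + 1) * tau.
  by rewrite /tau mulrC divfK// gt_eqF.
have : 0 < tau * ((C + 1) * ((size E)%:R + 1) - C * (size E)%:R).
  rewrite mulr_gt0// (_ : _ - _ = C + (size E)%:R + 1); last by ring.
  by rewrite ltr_wpDl// addr_ge0.
set e := (size E)%:R; nra.
Qed.

(** * Decorrelation under a product measure *)

(** A class closed under sums, products and averages and integrable for every finite measure, which
    settles the integrability side conditions uniformly. *)
Definition bounded_measurable (R : realType) d (T : measurableType d)
    (f : T -> R) : Prop :=
  measurable_fun [set: T] f /\ exists M, forall x, `|f x| <= M.

Section bounded_measurable_theory.
Context (R : realType) d (T : measurableType d).
Implicit Types f g : T -> R.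

Lemma bounded_measurable_cst (c : R) : bounded_measurable (fun _ : T => c).
Proof. by split; [exact: measurable_cst|exists `|c|]. Qed.

Lemma bounded_measurableD f g : bounded_measurable f -> bounded_measurable g ->
  bounded_measurable (fun x => f x + g x).
Proof.
move=> [mf [M fM]] [mg [N gN]]; split; first exact: measurable_funD.
by exists (M + N) => x; rewrite (le_trans (ler_normD _ _))// lerD.
Qed.

Lemma bounded_measurableM f g : bounded_measurable f -> bounded_measurable g ->
  bounded_measurable (fun x => f x * g x).
Proof.
move=> [mf [M fM]] [mg [N gN]]; split; first exact: measurable_funM.
by exists (M * N) => x; rewrite normrM ler_pM.
Qed.

Lemma bounded_measurable_sum (I : Type) (r : seq I) (f : I -> T -> R) :
  (forall i, bounded_measurable (f i)) ->
  bounded_measurable (fun x => \sum_(i <- r) f i x).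
Proof.
move=> bf; elim: r => [|i r IHr].
  under eq_fun do rewrite big_nil; exact: bounded_measurable_cst.
under eq_fun do rewrite big_cons; exact: bounded_measurableD.
Qed.

Lemma bounded_measurable_avg n (f : 'I_n -> T -> R) :
  (forall j, bounded_measurable (f j)) ->
  bounded_measurable (fun x => avg (fun j => f j x)).
Proof.
move=> bf; apply: bounded_measurableM; first exact: bounded_measurable_cst.
exact: bounded_measurable_sum.
Qed.

Lemma bounded_measurable_indic (A : set T) :
  measurable A -> bounded_measurable (\1_A : T -> R).
Proof.
move=> mA; split; first exact: measurable_indic.
by exists 1 => x; rewrite indicE; case: (_ \in _); rewrite ?normr1 ?normr0.
Qed.

Lemma bounded_measurable_integrable (mu : {finite_measure set T -> \bar R}) A f :
  measurable A -> bounded_measurable f -> mu.-integrable A (EFin \o f).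
Proof.
move=> mA [mf [M fM]]; apply: measurable_bounded_integrable => //.
- by rewrite ltey_eq fin_num_measure.
- exact: measurable_funTS.
- by exists M; split; [exact: num_real|move=> N /ltW MN x _; exact: le_trans MN].
Qed.


Context (mu : {finite_measure set T -> \bar R}) (A : set T) (mA : measurable A).
Let bi f := @bounded_measurable_integrable mu A f mA.

Lemma bounded_Rintegral_sum (I : Type) (r : seq I) (f : I -> T -> R) :
  (forall i, bounded_measurable (f i)) ->
  \int[mu]_(x in A) (\sum_(i <- r) f i x) = \sum_(i <- r) \int[mu]_(x in A) f i x.
Proof.
move=> bf; elim: r => [|i r IHr].
  by under eq_fun do rewrite big_nil; rewrite Rintegral_cst// mul0r big_nil.
under eq_fun do rewrite big_cons; rewrite RintegralD//.
- by rewrite big_cons IHr.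
- exact: bi.
- by apply: bi; exact: bounded_measurable_sum.
Qed.

Lemma bounded_Rintegral_avg n (f : 'I_n -> T -> R) :
  (forall j, bounded_measurable (f j)) ->
  \int[mu]_(x in A) avg (fun j => f j x) = avg (fun j => \int[mu]_(x in A) f j x).
Proof.
move=> bf; rewrite RintegralZl ?bounded_Rintegral_sum//.
by apply: bi; exact: bounded_measurable_sum.
Qed.

Lemma bounded_le_Rintegral f g : bounded_measurable f -> bounded_measurable g ->
  (forall x, A x -> f x <= g x) ->
  \int[mu]_(x in A) f x <= \int[mu]_(x in A) g x.
Proof. by move=> bf bg; apply: le_Rintegral => //; exact: bi. Qed.

Lemma Rintegral_subset_setT f : bounded_measurable f -> (forall x, 0 <= f x) ->
  \int[mu]_(x in A) f x <= \int[mu]_x f x.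
Proof.
move=> bf f0; have Tf := bounded_measurable_integrable mu measurableT bf.
apply: fine_le.
- by apply: integrable_fin_num => //; exact: bi.
- exact: integrable_fin_num.
apply: ge0_subset_integral => //; first by case/integrableP : Tf.
by move=> x _; rewrite lee_fin.
Qed.

End bounded_measurable_theory.

Lemma Rintegral_indicT (R : realType) d (T : measurableType d)
    (mu : {measure set T -> \bar R}) (A : set T) : measurable A ->
  \int[mu]_x \1_A x = fine (mu A).
Proof. by move=> mA; rewrite /Rintegral integral_indic// setIT. Qed.

Lemma avg_cauchy_schwarz (R : realType) n (w h : 'I_n -> R) :
  (forall j, `|w j| <= 1) ->
  avg (fun j => w j * h j) ^+ 2 <= avg (fun j => h j ^+ 2).
Proof.
move=> w1; case: n => [|n] in w h w1 *.
  by rewrite /avg !big_ord0 !mulr0 expr0n.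
(* With this [t], expanding the square below gives [avg h^2 - 2 t^2 + t^2 * avg w^2], and
   [avg w^2 <= 1]. *)
set t := avg (fun j => w j * h j).
have : 0 <= avg (fun j => (h j - t * w j) ^+ 2).
  by apply: avg_ge0 => j; exact: sqr_ge0.
rewrite (@eq_avg _ _ _ (fun j => h j ^+ 2 + (- (2 * t)) * (w j * h j) + t ^+ 2 * w j ^+ 2));
  last by move=> j; ring.
rewrite !avgD !avgZ -/t.
have : avg (fun j => w j ^+ 2) <= 1.
  rewrite -[leRHS](@avg_cst R n.+1 1)//; apply: le_avg => j.
  by rewrite -real_normK ?num_real// expr_le1.
move: (avg _) (avg _) => a b; have := sqr_ge0 t; nra.
Qed.

(* The vector h = (\int_A v_j)_j satisfies |h|^2 = \int_A \int_A <v x, v x'>,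
   and <w, h> is at least beta * P A. *)
Lemma correlation_bound (R : realType) dT (T : measurableType dT)
    (P : probability T R) n (v : 'I_n -> T -> R) (w : 'I_n -> R)
    (A : set T) (B : set (T * T)) (M delta beta : R) :
  (forall j, bounded_measurable (v j)) -> (forall j x, `|v j x| <= M) ->
  (forall j, `|w j| <= 1) -> measurable A -> measurable B ->
  0 <= delta -> 0 <= beta ->
  (forall x x', ~ B (x, x') -> avg (fun j => v j x * v j x') <= delta) ->
  (forall x, A x -> beta <= avg (fun j => w j * v j x)) ->
  (beta * fine (P A)) ^+ 2 <= delta + M ^+ 2 * fine ((P \x P)%E B).
Proof.
move=> bv vM w1 mA mB delta0 beta0 vB vA.
pose h j := \int[P]_(x in A) v j x.
have bcst (c : R) : bounded_measurable (fun _ : T => c) by exact: bounded_measurable_cst.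
have bavg (u : 'I_n -> R) : bounded_measurable (fun x => avg (fun j => u j * v j x)).
  by apply: bounded_measurable_avg => j; exact: bounded_measurableM.
have intavg (u : 'I_n -> R) :
    \int[P]_(x in A) avg (fun j => u j * v j x) = avg (fun j => u j * h j).
  rewrite bounded_Rintegral_avg//; last by move=> j; exact: bounded_measurableM.
  apply: eq_avg => j; rewrite RintegralZl//.
  exact: bounded_measurable_integrable.
have H1 : beta * fine (P A) <= avg (fun j => w j * h j).
  by rewrite -intavg -Rintegral_cst//; apply: bounded_le_Rintegral.
have H2 : (beta * fine (P A)) ^+ 2 <= avg (fun j => h j ^+ 2).
  apply: le_trans (avg_cauchy_schwarz _ w1).
  by rewrite ler_sqr// nnegrE ?(le_trans _ H1) ?mulr_ge0 ?fine_ge0.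
apply: le_trans H2 _.
have PT : fine (P [set: T]) = 1 by rewrite probability_setT.
(* The mass of the exceptional partners of [x]; its integral is the product measure of [B]. *)
pose g x := fine (P (xsection B x)).
have bg : bounded_measurable g.
  split.
    exact: (measurableT_comp (@fine_measurable R _ _) (measurable_fun_xsection P mB)).
  exists 1 => x; rewrite ger0_norm ?fine_ge0//.
  rewrite -[leRHS]/(fine 1%E) fine_le//.
    by rewrite fin_num_measure//; exact: measurable_xsection.
  by apply: probability_le1; exact: measurable_xsection.
(* Used twice: in [x'] for fixed [x], with the indicator of a section of [B], and in [x], with [g].
   Nonnegativity permits enlarging [A] to the whole space. *)
have affine (k : T -> R) : bounded_measurable k -> (forall x, 0 <= k x) ->
    \int[P]_(x in A) (delta + M ^+ 2 * k x) <= delta + M ^+ 2 * \int[P]_x k x.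
  move=> bk k0.
  have bMk : bounded_measurable (fun x => M ^+ 2 * k x) by exact: bounded_measurableM.
  apply: le_trans (Rintegral_subset_setT P mA _ _) _.
  - exact: bounded_measurableD.
  - by move=> x; rewrite addr_ge0// mulr_ge0 ?sqr_ge0.
  - rewrite RintegralD//; first last.
    + exact: (bounded_measurable_integrable _ _ bMk).
    + exact: (bounded_measurable_integrable _ _ (bcst delta)).
    rewrite Rintegral_cst// PT mulr1 RintegralZl//.
    exact: bounded_measurable_integrable.
have H3 x : avg (fun j => h j * v j x) <= delta + M ^+ 2 * g x.
  rewrite (@eq_avg _ _ _ (fun j => v j x * h j)) => [|j]; last exact: mulrC.
  have mS := measurable_xsection x mB.
  rewrite -intavg /g -Rintegral_indicT//; apply: le_trans (affine _ _ _).
  - apply: bounded_le_Rintegral => //.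
      apply: bounded_measurableD => //; apply: bounded_measurableM => //.
      exact: bounded_measurable_indic.
    move=> x' Ax'; rewrite indicE; case: (boolP (x' \in xsection B x)) => xx'.
      rewrite mulr1 ler_wpDl//.
      apply: le_trans (ler_norm _) _; apply: le_trans (normr_avg _) _.
      (* The average of a constant requires a nonempty index set, so [n = 0] is split off. *)
      case: n => [|n] in v bv vM w w1 h vB vA bavg intavg H1 *.
        by rewrite /avg big_ord0 mulr0 sqr_ge0.
      rewrite -[leRHS](@avg_cst R n.+1)//; apply: le_avg => j.
      by rewrite normrM expr2 ler_pM.
    rewrite mulr0 addr0; apply: vB => Bxx'.
    by move/negP : xx'; apply; rewrite mem_xsection inE.
  - exact: bounded_measurable_indic.
  - by move=> x'; rewrite indicE.
(* [intavg] with [h] itself as weight turns [|h|^2] into the integral over [A] of the quantity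
   bounded in [H3]. *)
rewrite (@eq_avg _ _ _ (fun j => h j * h j)) => [|j]; last exact: expr2.
rewrite -intavg; apply: (@le_trans _ _ (\int[P]_(x in A) (delta + M ^+ 2 * g x))).
  apply: bounded_le_Rintegral => //; apply: bounded_measurableD => //.
  exact: bounded_measurableM.
apply: le_trans (affine _ bg _) _; first by move=> x; rewrite fine_ge0.
rewrite lerD2l ler_wpM2l ?sqr_ge0// /Rintegral /product_measure1/=.
rewrite le_eqVlt; apply/orP; left; apply/eqP; congr fine.
apply: eq_integral => x _; rewrite fineK//.
by rewrite fin_num_measure//; exact: measurable_xsection.
Qed.

(** * Open events, union bounds and Haar integrals *)

Lemma forall_in_cons_setI (T : Type) (I : eqType) (k : I) (r : seq I)
    (A : I -> set T) :
  [set x | forall l, l \in k :: r -> A l x] =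
  A k `&` [set x | forall l, l \in r -> A l x].
Proof.
apply/seteqP; split => x /=.
  by move=> H; split=> [|l lr]; apply: H; rewrite inE ?eqxx// lr orbT.
by move=> [Akx H] l; rewrite inE => /orP[/eqP ->//|]; exact: H.
Qed.

Lemma continuous_avg (R : realType) (T : topologicalType) n
    (F : 'I_n -> T -> R) :
  (forall j, continuous (F j)) -> continuous (fun t => avg (fun j => F j t)).
Proof.
move=> cF; have : continuous (fun t => \sum_(j < n) F j t); last first.
  move=> cS t; apply: (@continuousM _ _ (fun=> n%:R^-1)); last exact: cS.
  exact: cst_continuous.
elim: (index_enum _) => [|j r IHr].
  by under eq_fun do rewrite big_nil; exact: cst_continuous.
under eq_fun do rewrite big_cons.
by move=> t; apply: continuousD; [exact: cF|exact: IHr].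
Qed.

Lemma continuous_sqr (R : realType) (T : topologicalType) (f : T -> R) :
  continuous f -> continuous (fun t => f t ^+ 2).
Proof.
move=> cf t; rewrite (_ : (fun _ => _) = f \* f); last first.
  by apply/funext => u; rewrite expr2.
by apply: continuousM; exact: cf.
Qed.

Lemma continuous_normr (R : realType) (T : topologicalType) (f : T -> R) :
  continuous f -> continuous (fun t => `|f t|).
Proof. by move=> cf t; apply: continuous_comp; [exact: cf|exact: norm_continuous]. Qed.

Lemma coordinate_continuous (X : topologicalType) n (j : 'I_n) :
  continuous (fun x : power X n => x j).
Proof. exact: (@proj_continuous _ (fun _ : 'I_n => X) j). Qed.

Section borel_measurability.
Context (R : realType) (X : ptopologicalType).

Lemma open_borel_measurable (A : set X) : open A -> measurable (A : set (borel X)).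
Proof. by move=> oA; apply: sub_sigma_algebra. Qed.

Lemma continuous_borel_measurable (f : X -> R) :
  continuous f -> measurable_fun [set: borel X] (f : borel X -> R).
Proof.
move=> /continuousP cf; apply: (measurability _ (RGenOpens.measurableE R)).
move=> _ [_ [a [b ->] <-]]; rewrite setTI; apply: open_borel_measurable.
exact/cf/interval_open.
Qed.

Lemma continuous_bounded_measurable (f : X -> R) (M : R) :
  continuous f -> (forall x, `|f x| <= M) ->
  bounded_measurable (f : borel X -> R).
Proof. by move=> cf fM; split; [exact: continuous_borel_measurable|exists M]. Qed.

End borel_measurability.

Section probability_bounds.
Context (R : realType) d (T : measurableType d) (P : probability T R).
Implicit Types A B : set T.

Lemma fine_probability A : measurable A -> (fine (P A))%:E = P A.
Proof. by move=> mA; rewrite fineK// fin_num_measure. Qed.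

Lemma fine_probability_le A B : measurable A -> measurable B -> A `<=` B ->
  fine (P A) <= fine (P B).
Proof.
by move=> mA mB AB; rewrite fine_le ?fin_num_measure// le_measure// inE.
Qed.

Lemma fine_probabilityC A : measurable A -> fine (P (~` A)) = 1 - fine (P A).
Proof.
by move=> mA; rewrite probability_setC// -[in LHS]fine_probability.
Qed.

Lemma probabilityI_ge A B (a b : R) : measurable A -> measurable B ->
  1 - a <= fine (P A) -> 1 - b <= fine (P B) ->
  1 - (a + b) <= fine (P (A `&` B)).
Proof.
move=> mA mB PA PB.
have mAB : measurable (A `&` B) by exact: measurableI.
have -> : A `&` B = ~` (~` A `|` ~` B) by rewrite setCU !setCK.
rewrite fine_probabilityC; last by apply: measurableU; exact: measurableC.
have : fine (P (~` A `|` ~` B)) <= fine (P (~` A)) + fine (P (~` B)).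
  rewrite -lee_fin EFinD !fine_probability//; try exact: measurableC.
    by apply: measureU2; exact: measurableC.
  by apply: measurableU; exact: measurableC.
by rewrite !fine_probabilityC//; lra.
Qed.

Lemma probability_bigcap_ge (I : eqType) (r : seq I) (A : I -> set T) (e : R) :
  (forall k, k \in r -> measurable (A k)) ->
  (forall k, k \in r -> 1 - e <= fine (P (A k))) ->
  measurable [set x | forall k, k \in r -> A k x] /\
  1 - (size r)%:R * e <= fine (P [set x | forall k, k \in r -> A k x]).
Proof.
elim: r => [|k r IHr] mA PA.
  rewrite (_ : [set x | _] = setT); last by apply/seteqP; split.
  by rewrite probability_setT mul0r subr0.
rewrite forall_in_cons_setI.
have [||mr Pr] := IHr.
- by move=> l lr; apply: mA; rewrite inE lr orbT.
- by move=> l lr; apply: PA; rewrite inE lr orbT.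
have mk : measurable (A k) by apply: mA; rewrite inE eqxx.
split; first exact: measurableI.
rewrite /= -nat1r mulrDl mul1r; apply: probabilityI_ge => //.
by apply: PA; rewrite inE eqxx.
Qed.

End probability_bounds.

Section haar_integral.
Context (R : realType) (X : topologicalGroupType) (m : probability (borel X) R).
Hypothesis m_haar : haar m.

Lemma mulg_left_continuous (y : X) : continuous (fun x : X => (y * x)%g).
Proof.
move=> x; apply: (@continuous_comp _ _ _ (fun x : X => (y, x))
  (fun p : X * X => (p.1 * p.2)%g)); last exact: mulg_continuous.
by apply: cvg_pair; [exact: cvg_cst|exact: cvg_id].
Qed.

Lemma haar_Rintegral (f : X -> R) (M : R) (y : X) :
  continuous f -> (forall x, `|f x| <= M) ->
  \int[m]_x f (y * x)%g = \int[m]_x f x.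
Proof.
move=> cf fM.
pose t (x : borel X) : borel X := (y * x)%g.
have mt : measurable_fun [set: borel X] t.
  apply: (@measurability _ _ (borel X) (borel X) _ _ (@open X)) => //.
  move=> _ [V oV <-]; rewrite setTI; apply: open_borel_measurable.
  by move/continuousP : (@mulg_left_continuous y); exact.
have bf := continuous_bounded_measurable cf fM.
have bft : bounded_measurable (fun x : borel X => f (t x)).
  apply: (@continuous_bounded_measurable R X (fun x : X => f (y * x)%g) M) => //.
  move=> x; apply: (@continuous_comp _ _ _ (fun x : X => (y * x)%g) f).
    exact: mulg_left_continuous.
  exact: cf.
(* [haar] speaks of images, so it is applied to the preimage of [A] under [t], whose image is [A]
   because translation is onto. *)
have inv (A : set (borel X)) : measurable A -> pushforward m t A = m A.
  move=> mA; have mtA : measurable (t @^-1` A).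
    by rewrite -[X in measurable X]setTI; exact: mt.
  transitivity (m (t @^-1` A)) => //; rewrite -(m_haar y mtA); congr (m _).
  apply/seteqP; split => x /=; first by move=> [x' Ax' <-].
  by move=> Ax; exists (y^-1 * x)%g; rewrite /t/= mulgA mulgV mul1g.
rewrite /Rintegral; congr fine.
transitivity (\int[pushforward m t]_x (f x)%:E)%E.
  rewrite (integral_pushforward mt)//.
  - by apply/measurable_EFinP; exact: (proj1 bf).
  - rewrite preimage_setT.
    exact: (bounded_measurable_integrable m measurableT bft).
by apply: eq_measure_integral => A mA _; exact: inv.
Qed.

End haar_integral.

Lemma open_seq_bigcap (T : topologicalType) (I : eqType) (r : seq I)
    (A : I -> set T) :
  (forall k, k \in r -> open (A k)) -> open [set x | forall k, k \in r -> A k x].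
Proof.
elim: r => [|k r IHr] oA.
  by rewrite (_ : [set x | _] = setT); [exact: openT|apply/seteqP; split].
rewrite forall_in_cons_setI.
apply: openI; first by apply: oA; rewrite inE eqxx.
by apply: IHr => l lr; apply: oA; rewrite inE lr orbT.
Qed.

Section open_microstates.
Context (R : realType) (G : groupType) (X : ptopologicalType)
  (a : topAction G X).

Lemma continuous_pair_coordinate (f : X * X -> R) n (g h : X -> X) (j k : 'I_n) :
  continuous f -> continuous g -> continuous h ->
  continuous (fun x : power X n => f (g (x j), h (x k))).
Proof.
move=> cf cg ch x.
apply: (@continuous_comp _ _ _ (fun x : power X n => (g (x j), h (x k))) f);
  last exact: cf.
by apply: cvg_pair; apply: continuous_comp;
  [exact: coordinate_continuous|exact: cg|exact: coordinate_continuous|exact: ch].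
Qed.

(** Openness serves Borel measurability; it comes from finitely many strict inequalities between
    continuous functions of the coordinates. *)
Lemma Map_open (rho : X -> X -> R) (F : {fset G}) (delta : R) n (s : G -> 'S_n) :
  continuous (fun p : X * X => rho p.1 p.2) -> 0 < delta ->
  open (Map a rho F delta s).
Proof.
move=> crho delta0; apply: open_seq_bigcap => g _.
rewrite [X in open X](_ : _ = [set x : power X n |
    avg (fun j => rho (a g (x j)) (x (s g j)) ^+ 2) < delta ^+ 2]); last first.
  by apply/funext => x; rewrite rho2_lt.
apply: open_lt_continuous; last exact: cst_continuous.
apply: continuous_avg => j.
apply: (@continuous_pair_coordinate (fun p => rho p.1 p.2 ^+ 2) _ (a g) id).
- exact: continuous_sqr crho.
- exact: act_continuous.
- by move=> x; exact: cvg_id.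
Qed.

Lemma Map_mu_open (mu : probability (borel X) R) (rho : X -> X -> R) (F : {fset G})
    (L : {fset (X -> R)}) (delta : R) n (s : G -> 'S_n) :
  continuous (fun p : X * X => rho p.1 p.2) ->
  (forall f, f \in L -> continuous f) -> 0 < delta ->
  open (Map_mu a mu rho F L delta s).
Proof.
move=> crho cL delta0; apply: openI; first exact: Map_open.
apply: open_seq_bigcap => f fL.
apply: open_lt_continuous; last exact: cst_continuous.
apply: continuous_normr => x; apply: (@continuousB _ _ _
  (fun x : power X n => avg (fun j => f (x j))) (fun=> \int[mu]_y f y));
  last exact: cst_continuous.
move: x; apply: (@continuous_avg R _ n (fun j (x : power X n) => f (x j))) => j x.
by apply: continuous_comp; [exact: coordinate_continuous|exact: cL].
Qed.

End open_microstates.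

Lemma near_probability_ge (R : realType) (d : nat -> measure_display)
    (T : forall i, measurableType (d i)) (P : forall i, probability (T i) R)
    (A : forall i, set (T i)) (eta : R) :
  0 < eta -> P i (A i) @[i --> \oo] --> (1%E : \bar R) ->
  \forall i \near \oo, 1 - eta <= fine (P i (A i)).
Proof.
move=> eta0 /fine_cvg/cvgrPdist_lt/(_ _ eta0); apply: filterS => i /=.
by move=> /(le_lt_trans (ler_norm _)); lra.
Qed.

(** The event lives on the product sigma-algebra, as a preimage under [zip_power], so that sections
    and marginals of [mu_ i \x mu_ i] can be taken. *)
Lemma lde_event (R : realType) (G : groupType) (X : ptopologicalType)
    (cmX : compact_metrizable R X) (a : topAction G X) (rho : X * X -> X * X -> R)
    (d : nat -> nat) (s : forall i, G -> 'S_(d i))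
    (mu_ : forall i, probability (borel (power X (d i))) R)
    (m : probability (borel X) R)
    (F : {fset G}) (L : {fset (X * X -> R)}) (delta eta : R) :
  lde_converges cmX a rho s mu_ m ->
  continuous (fun p : (X * X) * (X * X) => rho p.1 p.2) ->
  (forall f, f \in L -> continuous f) -> 0 < delta -> 0 < eta ->
  \forall i \near \oo,
    exists2 E : set (borel (power X (d i)) * borel (power X (d i))),
      measurable E /\ 1 - eta <= fine ((mu_ i \x mu_ i)%E E) &
      forall x x', E (x, x') ->
        Map_mu (diag_action a) (prod_prob cmX m m) rho F L delta (s i)
          (fun j => (x j, x' j)).
Proof.
move=> lde crho cL delta0 eta0.
have [/(near_probability_ge eta0) H _] := lde F L delta cL delta0.
apply: filterS H => i Hi.
exists (zip_power (n := d i) @^-1`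
  Map_mu (diag_action a) (prod_prob cmX m m) rho F L delta (s i)) => //.
split => //; rewrite -[X in measurable X]setTI.
apply: (zip_power_measurable (n := d i) cmX) => //.
by apply: open_borel_measurable; exact: Map_mu_open.
Qed.

Lemma prod_prob_Rintegral (R : realType) (X : ptopologicalType)
    (cmX : compact_metrizable R X) (m : probability (borel X) R)
    (f g : X -> R) (M N : R) :
  continuous f -> (forall x, `|f x| <= M) ->
  continuous g -> (forall x, `|g x| <= N) ->
  \int[prod_prob cmX m m]_p (f p.1 * g p.2) = (\int[m]_x f x) * (\int[m]_x g x).
Proof.
move=> cf fM cg gN.
have bf := continuous_bounded_measurable cf fM.
have bg := continuous_bounded_measurable cg gN.
pose h (p : X * X) : R := f p.1 * g p.2.
have ch : continuous h.
  move=> p; apply: (@continuousM _ _ (fun p : X * X => f p.1) (fun p => g p.2)).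
    by apply: continuous_comp; [exact: cvg_fst|exact: cf].
  by apply: continuous_comp; [exact: cvg_snd|exact: cg].
have bh : bounded_measurable (h : borel X * borel X -> R).
  apply: bounded_measurableM.
    split; last by exists M => p.
    exact: (measurableT_comp (proj1 bf) measurable_fst).
  split; last by exists N => p.
  exact: (measurableT_comp (proj1 bg) measurable_snd).
have ih : (m \x m)%E.-integrable [set: borel X * borel X] (EFin \o h).
  pose mm : probability (borel X * borel X)%type R := (m \x m)%E.
  exact: (bounded_measurable_integrable mm measurableT bh).
transitivity (fine (\int[(m \x m)%E]_p (h p)%:E)%E).
  rewrite /Rintegral; congr fine.
  rewrite /prod_prob integral_distribution//.
  by apply/measurable_EFinP; exact: continuous_borel_measurable.
rewrite -integral12_prod_meas1//.
transitivity (\int[m]_x (f x * \int[m]_y g y)).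
  rewrite /Rintegral; congr fine; apply: eq_integral => x _.
  rewrite /fubini_F /h/= -(@RintegralZl _ _ R m setT (g : borel X -> R) (f x))//.
    rewrite /Rintegral fineK//; apply: integrable_fin_num => //.
    apply: (@bounded_measurable_integrable _ _ _ m setT (fun y => f x * g y)) => //.
    by apply: bounded_measurableM => //; exact: bounded_measurable_cst.
  exact: bounded_measurable_integrable.
by rewrite RintegralZr//; exact: bounded_measurable_integrable.
Qed.

(** * Concentration of translates *)

Section empirical_concentration.
Context (R : realType) (G : groupType) (X : topologicalGroupType)
  (cmX : compact_metrizable R X) (a : topAction G X) (rho : X * X -> X * X -> R)
  (d : nat -> nat) (s : forall i, G -> 'S_(d i))
  (mu_ : forall i, probability (borel (power X (d i))) R)
  (m : probability (borel X) R).
Hypothesis d_gt0 : forall i, (0 < d i)%N.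
Hypothesis m_haar : haar m.
Hypothesis rho_continuous : continuous (fun p : (X * X) * (X * X) => rho p.1 p.2).
Hypothesis mu_lde : lde_converges cmX a rho s mu_ m.

(** The test function [v p.1 * v p.2] has integral [(\int v)^2 = 0] against the product measure, so
    its empirical average is small off a small set of pairs. *)
Lemma lde_decorrelation (v : X -> R) (M delta eta : R) :
  continuous v -> (forall x, `|v x| <= M) -> \int[m]_x v x = 0 ->
  0 < delta -> 0 < eta ->
  \forall i \near \oo,
    exists2 B : set (borel (power X (d i)) * borel (power X (d i))),
      measurable B /\ fine ((mu_ i \x mu_ i)%E B) <= eta &
      forall x x', ~ B (x, x') -> avg (fun j => v (x j) * v (x' j)) <= delta.
Proof.
move=> cv vM v0 delta0 eta0.
pose h (p : X * X) : R := v p.1 * v p.2.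
have ch f : f \in [fset h]%fset -> continuous f.
  rewrite inE => /eqP -> p.
  apply: (@continuousM _ _ (fun p : X * X => v p.1) (fun p => v p.2)).
    by apply: continuous_comp; [exact: cvg_fst|exact: cv].
  by apply: continuous_comp; [exact: cvg_snd|exact: cv].
apply: filterS (lde_event fset0 mu_lde rho_continuous ch delta0 eta0).
move=> i [E [mE PE] EP]; exists (~` E).
  split; first exact: measurableC.
  pose mm : probability (borel (power X (d i)) * borel (power X (d i)))%type R :=
    (mu_ i \x mu_ i)%E.
  by rewrite -/(mm _) (fine_probabilityC mm mE); move: PE; rewrite -/(mm _); lra.
move=> x x' /contrapT/EP[_ /(_ h)]; rewrite inE eqxx => /(_ isT).
rewrite (prod_prob_Rintegral cmX m cv vM cv vM) v0 mul0r subr0.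
by move=> /ltW; apply: le_trans; exact: ler_norm.
Qed.

(** The set [B] of exceptional pairs is found from [v], which is why the threshold in [i] can
    precede the quantifier over [w]. *)
Lemma weighted_concentration (v : X -> R) (beta eta : R) :
  compact [set: X] -> continuous v -> \int[m]_x v x = 0 -> 0 < beta -> 0 < eta ->
  \forall i \near \oo, forall w : 'I_(d i) -> R, (forall j, `|w j| <= 1) ->
    measurable ([set x | `|avg (fun j => w j * v (x j))| < beta]
      : set (borel (power X (d i)))) /\
    1 - eta <= fine (mu_ i [set x | `|avg (fun j => w j * v (x j))| < beta]).
Proof.
move=> cX cv v0 beta0 eta0.
have [M M0 vM] := compact_continuous_bounded cX cv.
have M20 : 0 < M ^+ 2 by rewrite exprn_gt0.
(* With [B] of mass at most [tau / M ^+ 2], [correlation_bound] yields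
   [tau + tau = (beta * (eta / 2)) ^+ 2], hence a bad set of mass at most [eta / 2]. *)
pose tau := (beta * (eta / 2)) ^+ 2 / 2.
have tau0 : 0 < tau by rewrite divr_gt0 ?exprn_gt0 ?mulr_gt0 ?divr_gt0.
apply: filterS (lde_decorrelation cv vM v0 tau0 (divr_gt0 tau0 M20)).
move=> i [B [mB PB] BP].
have cvj j : continuous (fun x : power X (d i) => v (x j)).
  by move=> x; apply: continuous_comp; [exact: coordinate_continuous|exact: cv].
have cw (w : 'I_(d i) -> R) :
    continuous (fun x : power X (d i) => avg (fun j => w j * v (x j))).
  apply: continuous_avg => j x.
  by apply: (@continuousM _ _ (fun=> w j)); [exact: cst_continuous|exact: cvj].
have half (w : 'I_(d i) -> R) (w1 : forall j, `|w j| <= 1)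
    (A := [set x : power X (d i) | avg (fun j => w j * v (x j)) < beta]) :
    measurable (A : set (borel (power X (d i)))) /\
    1 - eta / 2 <= fine (mu_ i A).
  have mA : measurable (A : set (borel (power X (d i)))).
    apply: open_borel_measurable; apply: open_lt_continuous; first exact: cw.
    exact: cst_continuous.
  split => //.
  have mCA : measurable (~` A : set (borel (power X (d i)))) by exact: measurableC.
  have := @correlation_bound R _ _ (mu_ i) (d i)
    (fun j (x : borel (power X (d i))) => v (x j)) w (~` A) B M tau beta
    (fun j => continuous_bounded_measurable (@cvj j) (fun x => vM (x j)))
    (fun j x => vM (x j)) w1 mCA mB (ltW tau0) (ltW beta0) BP.
  rewrite fine_probabilityC// => /(_ _)H.
  have {}H : (beta * (1 - fine (mu_ i A))) ^+ 2 <= (beta * (eta / 2)) ^+ 2.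
    apply: le_trans (H _) _ => [x /negP|]; first by rewrite -leNgt.
    rewrite [leRHS](_ : _ = tau + M ^+ 2 * (tau / M ^+ 2)).
      by rewrite lerD2l ler_wpM2l// ltW.
    by rewrite [X in _ + X]mulrC divfK ?gt_eqF// /tau -splitr.
  have PA1 : fine (mu_ i A) <= 1.
    rewrite -[leRHS]/(fine 1%E) fine_le ?fin_num_measure//.
    exact: probability_le1.
  move: H; rewrite ler_sqr ?nnegrE; first by rewrite ler_pM2l//; lra.
    by rewrite mulr_ge0 ?subr_ge0// ltW.
  by rewrite ltW// mulr_gt0 ?divr_gt0.
move=> w w1.
(* The weights [w] and [- w] give the two one-sided bounds, at a cost of [eta / 2] each. *)
have [m1 P1] := half w w1.
have [|m2 P2] := half (fun j => - w j); first by move=> j; rewrite normrN.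
rewrite (_ : [set x | _] = [set x | avg (fun j => w j * v (x j)) < beta] `&`
  [set x | avg (fun j => - w j * v (x j)) < beta]); last first.
  apply/seteqP; split => x /=; rewrite (@eq_avg _ _ (fun j => - w j * v (x j))
    (fun j => -1 * (w j * v (x j)))) ?avgZ ?mulN1r ?ltr_norml ?(ltrNl _ beta);
    try by move=> j; rewrite mulN1r mulNr.
    by move=> /andP[].
  by move=> [-> ->].
split; first exact: measurableI.
by rewrite [X in 1 - X]splitr; exact: probabilityI_ge.
Qed.

(** Compactness in [x] makes [f (z * x)] continuous in [z] uniformly in [x]; compactness in [z] then
    leaves finitely many centres. *)
Lemma left_translate_net (f : X -> R) (beta : R) :
  compact [set: X] -> continuous f -> 0 < beta ->
  exists (D : {fset X}) (k : X -> X), forall z, k z \in D /\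
    forall x, `|f (z * x)%g - f (k z * x)%g| <= beta.
Proof.
move=> cX cf beta0.
pose U y : set X := [set z | forall x, `|f (z * x)%g - f (y * x)%g| < beta].
have Uy y : nbhs y (U y).
  have /compact_near_coveringP/(_ X (nbhs y)
    (fun z x => `|f (z * x)%g - f (y * x)%g| < beta) _) := cX.
  suff H x : [set: X] x -> \forall x' \near x & z \near y,
      `|f (z * x')%g - f (y * x')%g| < beta.
    by move=> /(_ H); apply: filterS => z zx x; exact: zx.
  move=> _.
  pose h (p : X * X) : R := `|f (p.2 * p.1)%g - f (y * p.1)%g|.
  have ch : continuous h.
    apply: continuous_normr => p.
    apply: (@continuousB _ _ _ (fun p : X * X => f (p.2 * p.1)%g)
      (fun p => f (y * p.1)%g)).
      apply: (@continuous_comp _ _ _ (fun p : X * X => (p.2 * p.1)%g) f);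
        last exact: cf.
      apply: (@continuous_comp _ _ _ (fun p : X * X => (p.2, p.1))
        (fun p : X * X => (p.1 * p.2)%g)); last exact: mulg_continuous.
      by apply: cvg_pair; [exact: cvg_snd|exact: cvg_fst].
    apply: (@continuous_comp _ _ _ (fun p : X * X => (y * p.1)%g) f);
      last exact: cf.
    apply: (@continuous_comp _ _ _ fst); first exact: cvg_fst.
    exact: mulg_left_continuous.
  have oh : open [set p | h p < beta].
    by apply: open_lt_continuous => //; exact: cst_continuous.
  have H : nbhs (x, y) [set p | h p < beta].
    by apply: open_nbhs_nbhs; split => //=; rewrite /h subrr normr0.
  exact: H.
have [D _ coverD] : finite_subset_cover [set: X] (fun y => (U y)°) [set: X].
  move: cX; rewrite compact_cover; apply.
    by move=> y _; exact: open_interior.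
  by move=> y _; exists y => //; exact: Uy.
have kP z : exists y, y \in D /\ forall x, `|f (z * x)%g - f (y * x)%g| <= beta.
  have [y yD /interior_subset Uyz] := coverD z Logic.I.
  by exists y; split => // x; rewrite ltW// Uyz.
by exists D, (fun z => sval (cid (kP z))) => z; exact: (svalP (cid (kP z))).
Qed.

Lemma translate_concentration (f : X -> R) (beta eta : R) :
  compact [set: X] -> continuous f -> 0 < beta -> 0 < eta ->
  \forall i \near \oo, forall phi : 'I_(d i) -> X,
    let A := [set x : power X (d i) |
      `|avg (fun j => f (phi j * x j)%g) - \int[m]_x f x| < beta] in
    measurable (A : set (borel (power X (d i)))) /\ 1 - eta <= fine (mu_ i A).
Proof.
move=> cX cf beta0 eta0.
have [M M0 fM] := compact_continuous_bounded cX cf.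
have [D [k kP]] := left_translate_net cX cf (divr_gt0 beta0 (ltr0Sn R 1)).
set c := \int[m]_x f x.
(* The tolerances [beta / 2] and [eta] are shared among the members of [D]; the added 1 keeps [N]
   positive and the total strictly below [beta / 2]. *)
pose N : R := (size D)%:R + 1.
have N0 : 0 < N by rewrite ltr_wpDl.
pose v (y x : X) : R := f (y * x)%g - c.
have cfl y : continuous (fun x : X => f (y * x)%g).
  move=> x; apply: (@continuous_comp _ _ _ (fun x : X => (y * x)%g) f).
    exact: mulg_left_continuous.
  exact: cf.
have cv y : continuous (v y).
  by move=> x; apply: (@continuousB _ _ _ (fun x : X => f (y * x)%g) (fun=> c));
    [exact: cfl|exact: cst_continuous].
have v0 y : \int[m]_x v y x = 0.
  rewrite RintegralB//.
  - rewrite (haar_Rintegral m_haar y cf fM).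
    rewrite [X in _ - X](_ : _ = c * fine (m setT)); last exact: Rintegral_cst.
    by rewrite probability_setT mulr1 subrr.
  - apply: (@bounded_measurable_integrable _ _ _ m setT (fun x => f (y * x)%g)) => //.
    exact: (continuous_bounded_measurable (cfl y) (fun x => fM _)).
  - apply: (@bounded_measurable_integrable _ _ _ m setT (fun=> c)) => //.
    exact: bounded_measurable_cst.
have : \forall i \near \oo, forall y, y \in D ->
    forall w : 'I_(d i) -> R, (forall j, `|w j| <= 1) ->
    measurable ([set x | `|avg (fun j => w j * v y (x j))| < beta / 2 / N]
      : set (borel (power X (d i)))) /\
    1 - eta / N <= fine (mu_ i [set x | `|avg (fun j => w j * v y (x j))| < beta / 2 / N]).
  apply: near_fset => y _; apply: weighted_concentration => //.
    by rewrite !divr_gt0.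
  by rewrite divr_gt0.
move=> H; apply: filterS H => i conc phi; set A := [set x | _] => /=.
have mA : measurable (A : set (borel (power X (d i)))).
  apply: open_borel_measurable; apply: open_lt_continuous; last exact: cst_continuous.
  apply: continuous_normr => x.
  apply: (@continuousB _ _ _ (fun x : power X (d i) => avg (fun j => f (phi j * x j)%g))
    (fun=> c)); last exact: cst_continuous.
  move: x; apply: continuous_avg => j x.
  by apply: (@continuous_comp _ _ _ (fun x : power X (d i) => x j)
      (fun u => f (phi j * u)%g));
    [exact: coordinate_continuous|exact: cfl].
split => //.
(* Coordinates are sorted by the centre chosen for [phi j]; each class becomes a 0-1 weight. *)
pose w y (j : 'I_(d i)) : R := (k (phi j) == y)%:R.
have w1 y j : `|w y j| <= 1 by rewrite /w normr_nat; case: eqP.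
pose E y : set (power X (d i)) := [set x | `|avg (fun j => w y j * v y (x j))| < beta / 2 / N].
have [mE PE] := @probability_bigcap_ge _ _ _ (mu_ i) _ D E (eta / N)
  (fun y yD => (conc y yD _ (w1 y)).1) (fun y yD => (conc y yD _ (w1 y)).2).
apply: (@le_trans _ _ (1 - (size D)%:R * (eta / N))).
  rewrite lerD2l lerN2 mulrCA ler_piMr ?(ltW eta0)//.
  by rewrite ler_pdivrMr// mul1r lerDl.
apply: le_trans PE _; apply: fine_probability_le => //.
move=> x Ex; rewrite /A/=.
(* At each [j] only the summand [y = k (phi j)] survives; the first average is the error of
   replacing [phi j] by its centre. *)
have -> : avg (fun j => f (phi j * x j)%g) - c =
    avg (fun j => f (phi j * x j)%g - f (k (phi j) * x j)%g) +
    \sum_(y <- D) avg (fun j => w y j * v y (x j)).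
  rewrite -avg_sum -avgD -[X in _ - X](@avg_cst R (d i) c)// -avgB.
  apply: eq_avg => j; rewrite (big_fsetD1 (k (phi j))) ?(kP _).1//=.
  rewrite [X in _ + (_ + X)]big1_seq ?addr0 => [|y]; last first.
    by rewrite !inE /w => /andP[_ /andP[/negPf]]; rewrite eq_sym => -> _; rewrite mul0r.
  by rewrite /w eqxx mul1r /v addrA subrK.
rewrite [ltRHS]splitr; apply: le_lt_trans (ler_normD _ _) _.
apply: ler_ltD.
  apply: le_trans (normr_avg _) _; rewrite -[leRHS](@avg_cst R (d i))//.
  by apply: le_avg => j; exact: (kP _).2.
apply: le_lt_trans (ler_norm_sum _ _ _) _.
apply: (@le_lt_trans _ _ (\sum_(y <- D) (beta / 2 / N))).
  by rewrite big_seq [leRHS]big_seq; apply: ler_sum => y yD; exact/ltW/Ex.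
rewrite big_const_seq count_predT iter_addr_0 -[ltLHS]mulr_natl mulrCA.
by rewrite gtr_pMr ?divr_gt0// ltr_pdivrMr// mul1r ltrDl.
Qed.

End empirical_concentration.

(** * Translated microstates *)

(** First-moment argument: the mean number of [k] with [x \in B k] is at least [1 - eta] times the
    size of [S], so it cannot lie below the proportion [1 - 2 * eta] everywhere. Doubling [eta]
    creates the strict gap. *)
Lemma probability_pigeonhole (R : realType) d (T : measurableType d)
    (P : probability T R) (K : choiceType) (S : {fset K}) (B : K -> set T) (eta : R) :
  (forall k, measurable (B k)) -> (forall k, k \in S -> 1 - eta <= fine (P (B k))) ->
  0 < eta -> (0 < #|` S|)%N ->
  exists x, (1 - 2 * eta) * #|` S|%:R <= #|` [fset k in S | x \in B k]%fset|%:R.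
Proof.
move=> mB PB eta0 S0.
have SR : 0 < #|` S|%:R :> R by rewrite ltr0n.
apply: contrapT => /forallNP H.
pose f x : R := \sum_(k <- S) \1_(B k) x.
have fE x : f x = #|` [fset k in S | x \in B k]%fset|%:R.
  rewrite card_fset_sum1 natr_sum big_fset/= big_mkcond/=.
  by apply: eq_bigr => k _; rewrite indicE; case: (x \in B k).
have bB k : bounded_measurable (\1_(B k) : T -> R) by exact: bounded_measurable_indic.
have lo : (1 - eta) * #|` S|%:R <= \int[P]_x f x.
  rewrite bounded_Rintegral_sum// (@le_trans _ _ (\sum_(k <- S) (1 - eta)))//.
    by rewrite big_const_seq count_predT iter_addr_0 mulr_natr.
  by rewrite big_seq [leRHS]big_seq; apply: ler_sum => k kS; rewrite Rintegral_indicT// PB.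
have hi : \int[P]_x f x <= (1 - 2 * eta) * #|` S|%:R.
  apply: (@le_trans _ _ (\int[P]_x (fun _ : T => (1 - 2 * eta) * #|` S|%:R) x)).
    apply: bounded_le_Rintegral => //; first exact: bounded_measurable_sum.
      exact: bounded_measurable_cst.
    by move=> x _; rewrite leNgt; apply/negP => /ltW; rewrite fE; exact: H.
  have PT : fine (P setT) = 1 by rewrite probability_setT.
  by rewrite Rintegral_cst// PT mulr1.
by move: (le_trans lo hi); rewrite ler_pM2r//; lra.
Qed.

(** Squares of pseudometrics need not obey the triangle inequality; the 3 comes from
    [(B + C + D)^2 <= 3 * (B^2 + C^2 + D^2)]. *)
Lemma pseudometric_sqr_quasi_triangle (R : realType) (T : topologicalType)
    (rho' : T -> T -> R) (x1 x2 x3 x4 : T) : continuous_pseudometric rho' ->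
  rho' x1 x4 ^+ 2 <= 3 * (rho' x1 x2 ^+ 2 + rho' x2 x3 ^+ 2 + rho' x3 x4 ^+ 2).
Proof.
move=> pm.
have := pm_triangle pm x1 x2 x4; have := pm_triangle pm x2 x3 x4.
have := pm_ge0 pm x1 x4.
move: (rho' x1 x4) (rho' x1 x2) (rho' x2 x3) (rho' x3 x4) (rho' x2 x4) => A B C D E.
move=> A0 EE AE.
have : A ^+ 2 <= (B + C + D) ^+ 2 by rewrite ler_sqr ?nnegrE//; lra.
have := sqr_ge0 (B - C); have := sqr_ge0 (C - D); have := sqr_ge0 (B - D).
nra.
Qed.

Section translated_microstates.
Context (R : realType) (G : groupType) (d : nat -> nat)
  (s : forall i, G -> 'S_(d i)) (X : topologicalGroupType)
  (cmX : compact_metrizable R X) (a : autAction G X) (m : probability (borel X) R)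
  (rho : X * X -> X * X -> R)
  (mu_ : forall i, probability (borel (power X (d i))) R)
  (rhoX r : X -> X -> R).
Hypothesis s_sofic : sofic_approximation R s.
Hypothesis m_haar : haar m.
Hypothesis rho_pm : continuous_pseudometric rho.
Hypothesis rho_dg : dynamically_generating (diag_action a) rho.
Hypothesis mu_lde : lde_converges cmX a rho s mu_ m.
Hypothesis rhoX_pm : continuous_pseudometric rhoX.
Hypothesis rhoX_dg : dynamically_generating a rhoX.
Hypothesis r_pm : continuous_pseudometric r.

(** Controls almost equivariance for [rhoX] and for [r] together; [r] will be [rhoZ] pulled back to
    [X]. *)
Let Dx (u u' : X) : R := rhoX u u' ^+ 2 + r u u' ^+ 2.

Let cDx : continuous (fun p : X * X => Dx p.1 p.2).
Proof.
move=> p; apply: (@continuousD _ _ _ (fun p : X * X => rhoX p.1 p.2 ^+ 2)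
  (fun p => r p.1 p.2 ^+ 2)).
  exact: (continuous_sqr (pm_continuous rhoX_pm)).
exact: (continuous_sqr (pm_continuous r_pm)).
Qed.

Lemma translate_almost_equivariant (E : {fset G}) (tau : R) : 0 < tau ->
  exists (F : {fset G}) (delta : R), 0 < delta /\
    \forall i \near \oo, forall phi x x' : power X (d i),
      Map a rhoX F delta (s i) phi ->
      Map (diag_action a) rho F delta (s i) (fun j => (x j, x' j)) ->
      forall h, h \in E -> avg (fun j => Dx (a h (phi j * x j)%g)
        (phi (s i h j) * x (s i h j))%g) < tau.
Proof.
move=> tau0.
(* The triple [(phi, (x, x'))] is handled as one microstate, because [rho] measures [x] only as part
   of a pair; [D] reads off the product [phi * x]. *)
pose al g (w : X * (X * X)) : X * (X * X) := (a g w.1, diag_action a g w.2).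
pose q (w w' : X * (X * X)) : R := rhoX w.1 w'.1 ^+ 2 + rho w.2 w'.2 ^+ 2.
pose D (w w' : X * (X * X)) : R := Dx (w.1 * w.2.1)%g (w'.1 * w'.2.1)%g.
have cX : compact [set: X] by case: cmX.
have cW : compact [set: X * (X * X)] by rewrite -!setXTT; do 2 apply: compact_setX => //.
have alM g h w : al (g * h)%g w = al g (al h w).
  by rewrite /al !actM.
have cal g : continuous (al g).
  apply: (@continuous_pair _ _ _ (fun w : X * (X * X) => a g w.1)
    (fun w => diag_action a g w.2)).
    exact: (continuous_compose (@continuous_fst _ _) (act_continuous (t := a) (g := g))).
  exact: (continuous_compose (@continuous_snd _ _) (act_continuous (t := diag_action a) (g := g))).
have pairs (T U : topologicalType) (f : T -> U) :
    continuous f -> continuous (fun p : T * T => (f p.1, f p.2)).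
  move=> cf; apply: (@continuous_pair _ _ _ (fun p : T * T => f p.1) (fun p => f p.2)).
    exact: (continuous_compose (@continuous_fst _ _) cf).
  exact: (continuous_compose (@continuous_snd _ _) cf).
have cq : continuous (fun p : (X * (X * X)) * (X * (X * X)) => q p.1 p.2).
  have c1 := continuous_compose (pairs _ _ _ (@continuous_fst X (X * X)%type))
    (continuous_sqr (pm_continuous rhoX_pm)).
  have c2 := continuous_compose (pairs _ _ _ (@continuous_snd X (X * X)%type))
    (continuous_sqr (pm_continuous rho_pm)).
  by move=> p; exact: (continuousD (c1 p) (c2 p)).
have cmul : continuous (fun w : X * (X * X) => (w.1 * w.2.1)%g).
  apply: (@continuous_compose _ _ _ (fun w : X * (X * X) => (w.1, w.2.1))
    (fun p : X * X => (p.1 * p.2)%g)); last exact: mulg_continuous.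
  apply: (@continuous_pair _ _ _ fst (fun w : X * (X * X) => w.2.1)).
    exact: continuous_fst.
  exact: (continuous_compose (@continuous_snd _ _) (@continuous_fst _ _)).
have cD : continuous (fun p : (X * (X * X)) * (X * (X * X)) => D p.1 p.2).
  exact: (continuous_compose (pairs _ _ _ cmul) cDx).
have Dq w w' : 0 < D w w' -> exists g, 0 < q (al g w) (al g w').
  move=> Dww'; have [w1|/rhoX_dg[g gw]] := pselect (w.1 = w'.1); last first.
    by exists g; rewrite /q ltr_wpDr ?sqr_ge0// exprn_gt0.
  have [w2|/rho_dg[g gw]] := pselect (w.2 = w'.2); last first.
    by exists g; rewrite /q ltr_wpDl ?sqr_ge0// exprn_gt0.
  by move: Dww'; rewrite /D w1 w2 /Dx (pm_refl rhoX_pm) (pm_refl r_pm) expr0n addr0 ltxx.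
have [F [delta0 [delta00 H]]] : exists (F0 : {fset G}) (delta0 : R), 0 < delta0 /\
    \forall i \near \oo, forall phi : 'I_(d i) -> X * (X * X),
      (forall g, g \in F0 -> avg (fun j => q (al g (phi j)) (phi (s i g j))) < delta0) ->
      forall h, h \in E -> avg (fun j => D (al h (phi j)) (phi (s i h j))) < tau.
  apply: (microstate_domination s_sofic cW alM cal cq _ _ _ _ cD Dq) => //.
  - by move=> w w'; rewrite addr_ge0 ?sqr_ge0.
  - by move=> w; rewrite /q (pm_refl rhoX_pm) (pm_refl rho_pm) expr0n addr0.
  - by move=> w w'; rewrite /q (pm_sym rhoX_pm) (pm_sym rho_pm).
  - move=> w1 w2 w3 w4; rewrite /q.
    have := pseudometric_sqr_quasi_triangle w1.1 w2.1 w3.1 w4.1 rhoX_pm.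
    have := pseudometric_sqr_quasi_triangle w1.2 w2.2 w3.2 w4.2 rho_pm.
    by lra.
(* [q] is a sum of two squares, and each of the two microstate conditions contributes less than
   [delta0 / 2]. *)
have d20 : 0 < Num.sqrt (delta0 / 2) by rewrite sqrtr_gt0 divr_gt0.
exists F, (Num.sqrt (delta0 / 2)); split => //.
apply: filterS H => i H phi x x' Mphi Mx h hE.
have {}H := H (fun j => (phi j, (x j, x' j))) _ h hE.
rewrite (@eq_avg _ _ _ (fun j => D (al h (phi j, (x j, x' j)))
  (phi (s i h j), (x (s i h j), x' (s i h j))))); last first.
  by move=> j; rewrite /D/= aut_actM.
apply: H => g gF; rewrite /q avgD/=.
have := Mphi g gF; have := Mx g gF.
rewrite !rho2_lt// sqr_sqrtr ?divr_ge0 ?(ltW delta00)// /al/=; lra.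
Qed.

Lemma translate_microstate (F E : {fset G}) (L : {fset (X -> R)})
    (delta tau eta : R) :
  (forall f, f \in L -> continuous f) -> 0 < delta -> 0 < tau -> 0 < eta ->
  exists (F' : {fset G}) (delta' : R), 0 < delta' /\
    \forall i \near \oo, forall phi, Map a rhoX F' delta' (s i) phi ->
      exists A : set (borel (power X (d i))),
        [/\ measurable A, 1 - eta <= fine (mu_ i A) &
          forall x, A x ->
            Map_mu a m rhoX F L delta (s i) (fun j => (phi j * x j)%g) /\
            forall g, g \in E -> avg (fun j => r (a g (phi j * x j)%g)
              (phi (s i g j) * x (s i g j))%g ^+ 2) < tau].
Proof.
move=> cL delta0 tau0 eta0.
have [d_gt0 _ _] := s_sofic.
have cX : compact [set: X] by case: cmX.
(* The bound [delta ^+ 2] is for the [rhoX] part of [Dx] on [F], the bound [tau] for its [r] part on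
   [E]. *)
pose t := Num.min (delta ^+ 2) tau.
have t0 : 0 < t by rewrite lt_min exprn_gt0.
have eta20 : 0 < eta / 2 by rewrite divr_gt0.
have [F' [delta' [delta'0 equi]]] := translate_almost_equivariant (F `|` E)%fset t0.
exists F', delta'; split => //.
have := lde_event (L := fset0) F' mu_lde (pm_continuous rho_pm) _ delta'0 eta20.
move=> /(_ (fun f => ltac:(by rewrite inE))).
pose N : R := (size L)%:R + 1.
have N0 : 0 < N by rewrite ltr_wpDl.
have : \forall i \near \oo, forall f, f \in L -> forall phi : 'I_(d i) -> X,
    let A := [set x : power X (d i) |
      `|avg (fun j => f (phi j * x j)%g) - \int[m]_x f x| < delta] in
    measurable (A : set (borel (power X (d i)))) /\
    1 - eta / 2 / N <= fine (mu_ i A).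
  apply: near_fset => f fL.
  apply: (translate_concentration d_gt0 m_haar (pm_continuous rho_pm) mu_lde) => //.
    exact: cL.
  by rewrite divr_gt0.
move: equi; apply: filterS3 => i equi conc [B [mB PB] BP] phi Mphi.
pose A1 : set (borel (power X (d i))) := [set x | forall h, h \in (F `|` E)%fset ->
  avg (fun j => Dx (a h (phi j * x j)%g) (phi (s i h j) * x (s i h j))%g) < t].
have mA1 : measurable A1.
  apply: open_borel_measurable; apply: open_seq_bigcap => h _.
  apply: open_lt_continuous; last exact: cst_continuous.
  apply: continuous_avg => j.
  apply: (@continuous_pair_coordinate R X (fun p => Dx p.1 p.2) _
    (fun u => a h (phi j * u)%g) (fun u => (phi (s i h j) * u)%g)).
  - exact: cDx.
  - move=> u; apply: (@continuous_comp _ _ _ (fun u : X => (phi j * u)%g) (a h)).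
      exact: mulg_left_continuous.
    exact: act_continuous.
  - exact: mulg_left_continuous.
(* The good pairs lie in the product of [A1] with the whole space, whose product mass is the mass of
   [A1]. *)
have PA1 : 1 - eta / 2 <= fine (mu_ i A1).
  pose mm : probability (borel (power X (d i)) * borel (power X (d i)))%type R :=
    (mu_ i \x mu_ i)%E.
  have <- : mm (A1 `*` setT) = mu_ i A1.
    transitivity (mu_ i A1 * mu_ i setT)%E; first exact: product_measure1E.
    by rewrite probability_setT mule1.
  apply: le_trans PB _; apply: (@fine_probability_le _ _ _ mm) => //.
    exact: measurableX.
  move=> [x x'] /BP[Mxx' _]; split => //= h hFE.
  exact: equi Mphi Mxx' _ hFE.
have [mA2 PA2] := @probability_bigcap_ge _ _ _ (mu_ i) _ L
  (fun f => [set x : borel (power X (d i)) |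
      `|avg (fun j => f (phi j * x j)%g) - \int[m]_x f x| < delta]) (eta / 2 / N)
  (fun f fL => (conc f fL phi).1) (fun f fL => (conc f fL phi).2).
eexists; split.
- exact: measurableI mA1 mA2.
- rewrite [X in 1 - X]splitr; apply: probabilityI_ge => //.
  apply: le_trans PA2; rewrite lerD2l lerN2 mulrCA ler_piMr ?(ltW eta20)//.
  by rewrite ler_pdivrMr// mul1r lerDl.
- move=> x [A1x A2x]; split; last first.
    move=> g gE; have := A1x g; rewrite inE gE orbT => /(_ isT).
    rewrite /Dx avgD lt_min => /andP[_].
    by apply: le_lt_trans; rewrite lerDr; apply: avg_ge0 => j; exact: sqr_ge0.
  split; last by move=> f fL; exact: A2x.
  move=> g gF; rewrite rho2_lt//; have := A1x g; rewrite inE gF => /(_ isT).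
  rewrite /Dx avgD lt_min => /andP[+ _].
  by apply: le_lt_trans; rewrite lerDl; apply: avg_ge0 => j; exact: sqr_ge0.
Qed.

End translated_microstates.

(** * Entropy *)

Section extended_real_bounds.
Context (R : realType).
Local Open Scope ereal_scope.

Lemma limn_esup_le_add (u v : nat -> \bar R) (k : R) :
  (\forall i \near \oo, u i <= v i + k%:E) -> limn_esup u <= limn_esup v + k%:E.
Proof.
move=> uv; rewrite -leeBlDr//; apply: le_ereal_inf_tmp => _ [V VF <-].
(* [limn_esup] is an infimum over sets of the filter, so [V] may be cut down to the indices where
   the comparison holds. *)
rewrite leeBlDr//; apply: (@le_trans _ _ (ereal_sup [set u i |
    i in V `&` [set i | u i <= v i + k%:E]])).
  apply: ereal_inf_lbound; exists (V `&` [set i | u i <= v i + k%:E]) => //.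
  exact: filterI.
apply: ge_ereal_sup => _ [i [Vi uvi] <-]; apply: le_trans uvi _.
by rewrite leeD2r//; apply: ereal_sup_ubound; exists i.
Qed.

Lemma lne_le_add (x y : \bar R) (k : R) :
  0 <= x -> 0 <= y -> x <= (expR k)%:E * y -> lne x <= lne y + k%:E.
Proof.
move=> x0 y0 xy; have [yp|] := ltP 0 y; last first.
  move=> yn; have y00 : y = 0 by apply/eqP; rewrite eq_le y0 yn.
  by move: xy; rewrite y00 mule0 => xn; rewrite le0_lneNy// leNye.
have -> : lne y + k%:E = lne ((expR k)%:E * y).
  have ek : (expR k)%:E \in `]0, +oo] by rewrite in_itv/= lte_fin expR_gt0 leey.
  have ey : y \in `]0, +oo] by rewrite in_itv/= yp leey.
  by rewrite lneM// lne_EFin ?expR_gt0// expRK addeC.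
by rewrite lee_lne// in_itv/= leey andbT// mule_ge0// lee_fin expR_ge0.
Qed.

Lemma sep_number_ge0 (T : choiceType) (eps : R) (A : set T) (dist : T -> T -> R) :
  0 <= sep_number eps A dist.
Proof.
apply: ereal_sup_ubound; exists fset0; last by rewrite cardfs0.
by split => // x.
Qed.

Lemma le_sep_number (T : choiceType) (eps : R) (A B : set T) (dist : T -> T -> R) :
  A `<=` B -> sep_number eps A dist <= sep_number eps B dist.
Proof.
move=> AB; apply: ereal_sup_le => _ [S [SA sepS] <-]; exists S => //.
by split => // x /SA /AB.
Qed.

(** As [d i >= 1], the logarithm [k] of the factor is still at most [k] after division by [d i]. *)
Lemma entropy_rate_le_add (Z : topologicalType) (d : nat -> nat)
    (A B : forall i, set (power Z (d i))) (rhoZ : Z -> Z -> R)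
    (eps eps' k : R) :
  (forall i, (0 < d i)%N) -> (0 <= k)%R ->
  (\forall i \near \oo, sep_number eps (A i) (rho2 rhoZ) <=
    (expR k)%:E * sep_number eps' (B i) (rho2 rhoZ)) ->
  entropy_rate A rhoZ eps <= entropy_rate B rhoZ eps' + k%:E.
Proof.
move=> d0 k0 AB; apply: limn_esup_le_add; apply: filterS AB => i ABi.
have dpos : (0 < (d i)%:R :> R)%R by rewrite ltr0n.
have dinv : 0 <= ((d i)%:R^-1)%:E :> \bar R by rewrite lee_fin invr_ge0 ltW.
apply: le_trans (lee_wpmul2l dinv (lne_le_add _ _ ABi)) _;
  try exact: sep_number_ge0.
rewrite muleDr//; last by rewrite fin_num_adde_defl.
rewrite leeD2l// -EFinM lee_fin ler_piMl// invf_le1// ler1n; exact: d0.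
Qed.

End extended_real_bounds.

(** * Comparison of separation numbers in a factor *)

Section presence.
Context (R : realType) (G : groupType) (d : nat -> nat)
  (s : forall i, G -> 'S_(d i)) (X : topologicalGroupType)
  (cmX : compact_metrizable R X) (a : autAction G X) (m : probability (borel X) R)
  (rho : X * X -> X * X -> R)
  (mu_ : forall i, probability (borel (power X (d i))) R)
  (Z : topologicalType) (pi : X -> Z) (rhoX : X -> X -> R) (rhoZ : Z -> Z -> R).
Hypothesis s_sofic : sofic_approximation R s.
Hypothesis m_haar : haar m.
Hypothesis rho_pm : continuous_pseudometric rho.
Hypothesis rho_dg : dynamically_generating (diag_action a) rho.
Hypothesis mu_lde : lde_converges cmX a rho s mu_ m.
Hypothesis rhoX_pm : continuous_pseudometric rhoX.
Hypothesis rhoX_dg : dynamically_generating a rhoX.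
Hypothesis pi_continuous : continuous pi.
Hypothesis rhoZ_pm : continuous_pseudometric rhoZ.
(** Translation by [z] may bring [rhoZ] down to 0, but some [g] must still detect the difference.
    This form covers quotient maps and the identity alike. *)
Hypothesis pi_translate : forall x y z, 0 < rhoZ (pi x) (pi y) ->
  exists g, 0 < rhoZ (pi (a g (x * z)%g)) (pi (a g (y * z)%g)).

Let r (x y : X) : R := rhoZ (pi x) (pi y).

Let r_pm : continuous_pseudometric r.
Proof.
split=> [x y|x|x y|x y z|].
- exact: (pm_ge0 rhoZ_pm).
- exact: (pm_refl rhoZ_pm).
- exact: (pm_sym rhoZ_pm).
- exact: (pm_triangle rhoZ_pm).
- apply: (@continuous_compose _ _ _ (fun p : X * X => (pi p.1, pi p.2))
    (fun p : Z * Z => rhoZ p.1 p.2)); last exact: (pm_continuous rhoZ_pm).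
  apply: (@continuous_pair _ _ _ (fun p : X * X => pi p.1) (fun p => pi p.2)).
    exact: (continuous_compose (@continuous_fst _ _) pi_continuous).
  exact: (continuous_compose (@continuous_snd _ _) pi_continuous).
Qed.

(** Making the translating element a third variable of the compact space yields [E] and [eps']
    independent of [i], [phi], [psi] and [x]. *)
Lemma translate_separated (eps : R) : 0 < eps ->
  exists (E : {fset G}) (eps' : R), 0 < eps' /\
    forall i (phi psi x : power X (d i)),
      (forall g, g \in E -> avg (fun j => r (a g (phi j * x j)%g)
        (phi (s i g j) * x (s i g j))%g ^+ 2) < eps' ^+ 2) ->
      (forall g, g \in E -> avg (fun j => r (a g (psi j * x j)%g)
        (psi (s i g j) * x (s i g j))%g ^+ 2) < eps' ^+ 2) ->
      avg (fun j => r (phi j * x j)%g (psi j * x j)%g ^+ 2) <= eps' ^+ 2 ->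
      avg (fun j => r (phi j) (psi j) ^+ 2) < eps ^+ 2.
Proof.
move=> eps0.
have [d_gt0 _ _] := s_sofic.
have cX : compact [set: X] by case: cmX.
have cT : compact [set: (X * X) * X] by rewrite -!setXTT; do 2 apply: compact_setX => //.
have cr := continuous_sqr (pm_continuous r_pm).
have cu : continuous (fun p : (X * X) * X => r p.1.1 p.1.2 ^+ 2).
  exact: (continuous_compose (@continuous_fst _ X) cr).
have cmul (f : X * X -> X) : continuous f ->
    continuous (fun p : (X * X) * X => (f p.1 * p.2)%g).
  move=> cf; apply: (@continuous_compose _ _ _ (fun p : (X * X) * X => (f p.1, p.2))
    (fun p : X * X => (p.1 * p.2)%g)); last exact: mulg_continuous.
  apply: (@continuous_pair _ _ _ (fun p : (X * X) * X => f p.1) snd).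
    exact: (continuous_compose (@continuous_fst _ _) cf).
  exact: continuous_snd.
have cv g : continuous (fun p : (X * X) * X =>
    r (a g (p.1.1 * p.2)%g) (a g (p.1.2 * p.2)%g) ^+ 2).
  apply: (@continuous_compose _ _ _ (fun p : (X * X) * X =>
    (a g (p.1.1 * p.2)%g, a g (p.1.2 * p.2)%g))
    (fun p : X * X => r p.1 p.2 ^+ 2)); last exact: cr.
  apply: (@continuous_pair _ _ _ (fun p : (X * X) * X => a g (p.1.1 * p.2)%g)
    (fun p : (X * X) * X => a g (p.1.2 * p.2)%g)).
    exact: (continuous_compose (cmul _ (@continuous_fst _ _))
      (act_continuous (t := a) (g := g))).
  exact: (continuous_compose (cmul _ (@continuous_snd _ _))
    (act_continuous (t := a) (g := g))).
have e20 : 0 < eps ^+ 2 / 2 by rewrite divr_gt0 ?exprn_gt0.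
have uv (p : (X * X) * X) : 0 < r p.1.1 p.1.2 ^+ 2 ->
    exists g, 0 < r (a g (p.1.1 * p.2)%g) (a g (p.1.2 * p.2)%g) ^+ 2.
  rewrite exprn_even_gt0//= => r0.
  have [|g gr] := @pi_translate p.1.1 p.1.2 p.2.
    by rewrite lt_neqAle eq_sym r0 (pm_ge0 rhoZ_pm).
  by exists g; rewrite exprn_gt0.
have [E [C [C0 EC]]] := compact_domination 1%g cT cu cv (fun g p => sqr_ge0 _) uv e20.
(* The count of [microstate_domination] again: [9 * t] for each [g] with [t = eps' ^+ 2], and
   [eps ^+ 2 / 2] available for the sum. *)
pose K := 18 * (C + 1) * ((size E)%:R + 1).
have K0 : 0 < K by rewrite !mulr_gt0 ?ltr_wpDl.
exists E, (Num.sqrt (eps ^+ 2 / K)); rewrite sqrtr_gt0 divr_gt0 ?exprn_gt0//; split => //.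
rewrite sqr_sqrtr ?divr_ge0 ?sqr_ge0 ?(ltW K0)//.
have {e20} : 0 < eps ^+ 2 / K by rewrite divr_gt0 ?exprn_gt0.
have : eps ^+ 2 = K * (eps ^+ 2 / K) by rewrite mulrC divfK ?gt_eqF.
move: (eps ^+ 2 / K) => t epsE t0 i phi psi x Hphi Hpsi Hx.
have step g : g \in E -> avg (fun j => r (a g (phi j * x j)%g) (a g (psi j * x j)%g) ^+ 2)
    <= 9 * t.
  move=> gE; have := Hphi g gE; have := Hpsi g gE.
  have : avg (fun j => r (phi (s i g j) * x (s i g j))%g
      (psi (s i g j) * x (s i g j))%g ^+ 2) <= t.
    by rewrite (avg_perm (s i g) (fun j => r (phi j * x j)%g (psi j * x j)%g ^+ 2)).
  have : avg (fun j => r (a g (phi j * x j)%g) (a g (psi j * x j)%g) ^+ 2) <=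
    avg (fun j => 3 * (r (a g (phi j * x j)%g) (phi (s i g j) * x (s i g j))%g ^+ 2 +
      r (phi (s i g j) * x (s i g j))%g (psi (s i g j) * x (s i g j))%g ^+ 2 +
      r (a g (psi j * x j)%g) (psi (s i g j) * x (s i g j))%g ^+ 2)).
    apply: le_avg => j.
    rewrite [X in _ + _ + X ^+ 2](pm_sym r_pm).
    exact: pseudometric_sqr_quasi_triangle.
  by rewrite avgZ !avgD; lra.
apply: (@le_lt_trans _ _ (avg (fun j => eps ^+ 2 / 2 + C * \sum_(g <- E)
    r (a g (phi j * x j)%g) (a g (psi j * x j)%g) ^+ 2))).
  by apply: le_avg => j; exact: (EC (phi j, psi j, x j)).
rewrite avgD avg_cst// avgZ avg_sum.
apply: (@le_lt_trans _ _ (eps ^+ 2 / 2 + C * ((size E)%:R * (9 * t)))).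
  rewrite lerD2l ler_wpM2l//.
  rewrite (_ : _ * _ = \sum_(g <- E) 9 * t); last first.
    by rewrite big_const_seq count_predT iter_addr_0 -[RHS]mulr_natl.
  by rewrite big_seq [leRHS]big_seq; apply: ler_sum => g; exact: step.
rewrite epsE /K.
have : 0 < t * ((C + 1) * ((size E)%:R + 1) - C * (size E)%:R).
  rewrite mulr_gt0// (_ : _ - _ = C + (size E)%:R + 1); last by ring.
  by rewrite ltr_wpDl// addr_ge0.
set e := (size E)%:R; nra.
Qed.

(* The factor is exp k for every k > 0 rather than one constant because d i need
   not tend to infinity (G may be finite). *)
Lemma sep_number_presence_le (eps : R) : 0 < eps -> exists eps', 0 < eps' /\
  forall (F : {fset G}) (L : {fset (X -> R)}) (delta k : R),
    (forall f, f \in L -> continuous f) -> 0 < delta -> 0 < k ->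
  exists (F' : {fset G}) (delta' : R), 0 < delta' /\
    \forall i \near \oo,
      (sep_number eps (map_power pi (n := d i) @` Map a rhoX F' delta' (s i))
        (rho2 rhoZ) <=
      (expR k)%:E * sep_number eps'
        (map_power pi (n := d i) @` Map_mu a m rhoX F L delta (s i)) (rho2 rhoZ))%E.
Proof.
move=> eps0; have [E [eps' [eps'0 sepE]]] := translate_separated eps0.
exists eps'; split => // F L delta k cL delta0 k0.
(* Chosen so that the surviving proportion [1 - 2 * eta] equals [expR (- k)]. *)
pose eta := (1 - expR (- k)) / 2.
have eta0 : 0 < eta by rewrite divr_gt0// subr_gt0 expR_lt1 oppr_lt0.
have [F' [delta' [delta'0 H]]] := translate_microstate s_sofic m_haar rho_pm
  rho_dg mu_lde rhoX_pm rhoX_dg r_pm F E cL delta0 (exprn_gt0 2 eps'0) eta0.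
exists F', delta'; split => //; apply: filterS H => i H.
apply: ge_ereal_sup => _ [S [SMap Ssep] <-].
have [/eqP S0|S0] := boolP (#|` S| == 0)%N.
  by rewrite S0 mule_ge0 ?lee_fin ?expR_ge0// sep_number_ge0.
have liftP z : exists phi, z \in S ->
    Map a rhoX F' delta' (s i) phi /\ map_power pi phi = z.
  have [zS|_] := boolP (z \in S); last by exists point.
  by have [phi Mphi phiz] := SMap z zS; exists phi.
pose lift z := sval (cid (liftP z)).
have liftE z : z \in S -> Map a rhoX F' delta' (s i) (lift z) /\
    map_power pi (lift z) = z.
  exact: (svalP (cid (liftP z))).
(* Outside [S] the value is [setT], since the pigeonhole asks for measurability at every index. *)
have BP z : exists B : set (borel (power X (d i))), measurable B /\
    (z \in S -> 1 - eta <= fine (mu_ i B) /\ forall x, B x ->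
      Map_mu a m rhoX F L delta (s i) (fun j => (lift z j * x j)%g) /\
      forall g, g \in E -> avg (fun j => r (a g (lift z j * x j)%g)
        (lift z (s i g j) * x (s i g j))%g ^+ 2) < eps' ^+ 2).
  have [zS|_] := boolP (z \in S); last by exists setT.
  by have [B [mB PB BM]] := H (lift z) (liftE z zS).1; exists B.
pose B z := sval (cid (BP z)).
have mB z : measurable (B z) by exact: (svalP (cid (BP z))).1.
have BS z : z \in S -> 1 - eta <= fine (mu_ i (B z)) /\ forall x, B z x ->
      Map_mu a m rhoX F L delta (s i) (fun j => (lift z j * x j)%g) /\
      forall g, g \in E -> avg (fun j => r (a g (lift z j * x j)%g)
        (lift z (s i g j) * x (s i g j))%g ^+ 2) < eps' ^+ 2.
  exact: (svalP (cid (BP z))).2.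
have [x] := probability_pigeonhole mB (fun z zS => (BS z zS).1) eta0
  (ltac:(by rewrite lt0n)).
set S1 := [fset z in S | x \in B z]%fset.
have -> : 1 - 2 * eta = expR (- k) by rewrite /eta mulrC divfK// opprB addrC subrK.
rewrite expRN mulrC ler_pdivrMr ?expR_gt0// mulrC => cardS.
have S1P z : z \in S1 -> z \in S /\ B z x.
  by rewrite !inE/= => /andP[-> /set_mem].
pose tr z : power Z (d i) := map_power pi (fun j => (lift z j * x j)%g).
(* Contrapositive of [sepE]: translates within [eps'] would put [z] and [z'] within [eps]. *)
have tr_sep z z' : z \in S1 -> z' \in S1 -> z != z' -> eps' < rho2 rhoZ (tr z) (tr z').
  move=> /S1P[zS Bz] /S1P[z'S Bz'] zz'; rewrite ltNge; apply/negP.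
  rewrite rho2_le ?(ltW eps'0)// => close.
  have := Ssep z z' zS z'S zz'.
  rewrite -[in X in _ < X](liftE z zS).2 -[in X in _ < X](liftE z' z'S).2.
  apply/negP; rewrite -leNgt ltW// rho2_lt//.
  by apply: (sepE i _ _ x) => //; [exact: ((BS z zS).2 x Bz).2|exact: ((BS z' z'S).2 x Bz').2].
(* Injectivity, which follows from separation at a positive scale, keeps the cardinality of [S1]. *)
have tr_inj : {in S1 &, injective tr}.
  move=> z z' zS z'S trE; apply/eqP; apply: contraT => /(tr_sep _ _ zS z'S).
  rewrite trE ltNge rho2_le ?(ltW eps'0)//.
  rewrite /avg big1 ?mulr0 ?sqr_ge0// => j _.
  by rewrite (pm_refl rhoZ_pm) expr0n.
apply: (@le_trans _ _ ((expR k)%:E * (#|` S1|%:R)%:E)%E).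
  by rewrite -EFinM lee_fin.
rewrite lee_wpmul2l ?lee_fin ?expR_ge0//.
apply: ereal_sup_ubound; exists (tr @` S1)%fset; last first.
  by rewrite card_in_imfset.
split=> [_ /imfsetP[z /= zS1 ->]|_ _ /imfsetP[z /= zS1 ->] /imfsetP[z' /= z'S1 ->] trE].
  have [zS Bz] := S1P z zS1.
  by exists (fun j => (lift z j * x j)%g) => //; exact: ((BS z zS).2 x Bz).1.
by apply: tr_sep => //; apply: contraNneq trE => ->.
Qed.

(** The supremum over scales stands outside the infimum over [F], [L], [delta], so [eps'] has to be
    fixed before these; the loss [k] tends to 0 last. The reverse inequality is inclusion of
    microstate sets. *)
Lemma entropy_presence_eq :
  top_entropy_presence a pi rhoX rhoZ s = measure_entropy_presence a m pi rhoX rhoZ s.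
Proof.
have [d_gt0 _ _] := s_sofic.
apply/eqP; rewrite eq_le; apply/andP; split.
  apply: ge_ereal_sup => _ [eps /= eps0 <-].
  have [eps' [eps'0 sep]] := sep_number_presence_le eps0.
  apply: (@le_trans _ _ (ereal_inf [set entropy_rate (fun i =>
      map_power pi (n := d i) @` Map_mu a m rhoX p.1.1 p.1.2 p.2 (s i)) rhoZ eps'
      | p in [set p : {fset G} * {fset (X -> R)} * R |
          (forall f, f \in p.1.2 -> continuous f) /\ 0 < p.2]])); last first.
    by apply: ereal_sup_ubound; exists eps'.
  apply: le_ereal_inf_tmp => _ [[[F L] delta] /= [cL delta0] <-].
  apply/lee_addgt0Pr => k k0.
  have [F' [delta' [delta'0 H]]] := sep F L delta k cL delta0 k0.
  apply: le_trans (entropy_rate_le_add d_gt0 (ltW k0) H).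
  by apply: ereal_inf_lbound; exists (F', delta').
apply: ge_ereal_sup => _ [eps /= eps0 <-].
apply: (@le_trans _ _ (ereal_inf [set entropy_rate (fun i =>
    map_power pi (n := d i) @` Map a rhoX p.1 p.2 (s i)) rhoZ eps
    | p in [set p : {fset G} * R | 0 < p.2]])); last first.
  by apply: ereal_sup_ubound; exists eps.
apply: le_ereal_inf_tmp => _ [[F delta] /= delta0 <-].
apply: (@le_trans _ _ (entropy_rate (fun i =>
    map_power pi (n := d i) @` Map_mu a m rhoX F fset0 delta (s i)) rhoZ eps)).
  apply: ereal_inf_lbound; exists (F, fset0, delta) => //=.
rewrite -[leRHS]adde0; apply: (entropy_rate_le_add d_gt0 (lexx 0)).
near=> i; rewrite expR0 mul1e; apply: le_sep_number.
by apply: image_subset => phi [].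
Unshelve. all: by end_near.
Qed.

End presence.

(** [(x z)^-1 (y z)] is a conjugate of [x^-1 y] by [z], and normality of [Y] undoes the
    conjugation. *)
Lemma quotient_map_mulgr (G : groupType) (X : topologicalGroupType)
    (a : autAction G X) (Y : closedNormalInvariant a) (x y z : X) :
  quotient_map Y (x * z)%g = quotient_map Y (y * z)%g ->
  quotient_map Y x = quotient_map Y y.
Proof.
move=> /quotient_map_eq Yxy; apply/quotient_map_eq.
have := cni_normal (z^-1)%g Yxy.
by rewrite invgK invgM !mulgA mulgV mul1g -!mulgA mulgV mulg1.
Qed.

Theorem theorem1p1 (R : realType) (G : groupType)
  (G_countable : countable [set: G])
  (d : nat -> nat) (s : forall i, G -> 'S_(d i))
  (s_sofic : sofic_approximation R s)
  (X : topologicalGroupType) (cmX : compact_metrizable R X)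
  (a : autAction G X)
  (m : probability (borel X) R) (m_haar : haar m)
  (rho : X * X -> X * X -> R)
  (rho_pm : continuous_pseudometric rho)
  (rho_dg : dynamically_generating (diag_action a) rho)
  (mu_ : forall i, probability (borel (power X (d i))) R)
  (mu_lde : lde_converges cmX a rho s mu_ m) :
  (forall (Y : closedNormalInvariant a)
      (rhoX : X -> X -> R) (rhoZ : quotient Y -> quotient Y -> R),
    continuous_pseudometric rhoX -> dynamically_generating a rhoX ->
    continuous_pseudometric rhoZ ->
    dynamically_generating (quotient_action Y) rhoZ ->
    top_entropy_presence a (@quotient_map G X a Y) rhoX rhoZ s =
    measure_entropy_presence a m (@quotient_map G X a Y) rhoX rhoZ s) /\
  (forall rhoX rhoX' : X -> X -> R,
    continuous_pseudometric rhoX -> dynamically_generating a rhoX ->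
    continuous_pseudometric rhoX' -> dynamically_generating a rhoX' ->
    top_entropy a rhoX rhoX' s = measure_entropy a m rhoX rhoX' s).
Proof.
have pi_translate (Z : topologicalType) (b : topAction G Z) (pi : X -> Z)
    (rhoZ : Z -> Z -> R) :
    (forall g x, pi (a g x) = b g (pi x)) ->
    (forall x y z, pi (x * z)%g = pi (y * z)%g -> pi x = pi y) ->
    continuous_pseudometric rhoZ -> dynamically_generating b rhoZ ->
    forall x y z, 0 < rhoZ (pi x) (pi y) ->
      exists g, 0 < rhoZ (pi (a g (x * z)%g)) (pi (a g (y * z)%g)).
  (* Positive distance forces distinct projections of [x] and [y], hence of [x * z] and [y * z], and
     [rhoZ] generates. *)
  move=> equiv inj pm dg x y z xy.
  have [|g gr] := dg (pi (x * z)%g) (pi (y * z)%g).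
    by move=> /inj pixy; move: xy; rewrite pixy (pm_refl pm) ltxx.
  by exists g; rewrite !equiv.
split=> [Y rhoX rhoZ rhoX_pm rhoX_dg rhoZ_pm rhoZ_dg|
    rhoX rhoX' rhoX_pm rhoX_dg rhoX'_pm rhoX'_dg].
  apply: (entropy_presence_eq s_sofic m_haar rho_pm rho_dg mu_lde) => //.
    exact: pi_continuous.
  apply: (pi_translate _ (quotient_action Y)) => //.
    exact: quotient_map_equivariant.
  exact: quotient_map_mulgr.
(* The case of trivial [Y] is run with [pi = id], because [rhoX'] lives on [X] and not on a quotient
   type; cancellation in the group replaces normality. *)
apply: (entropy_presence_eq s_sofic m_haar rho_pm rho_dg mu_lde) => //.
  by move=> x; exact: cvg_id.
apply: (pi_translate _ a id) => // x y z; exact: mulIg.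
Qed.
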